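(* Let $p$ be an odd prime, $a\in\mathbb{Z}_p$ with $a\not\equiv0,-1\pmod p$, put $a'=(a-\langle a\rangle_p)/p$ and $Q_p(a)=\sum_{k=0}^{p-1}(a-2k)\binom ak^4$. If $\langle a\rangle_p<\frac p2$, then $$Q_p(a)\equiv a'p(-1)^{\langle a\rangle_p}\binom{2\langle a\rangle_p}{\langle a\rangle_p}\Big(1+2a'p(H_{2\langle a\rangle_p}-H_{\langle a\rangle_p})+a'^2p^2\big(2(H_{2\langle a\rangle_p}-H_{\langle a\rangle_p})^2-2H^{(2)}_{2\langle a\rangle_p}+H^{(2)}_{\langle a\rangle_p}\big)\Big)\pmod{p^4}.$$ If $\langle a\rangle_p>\frac p2$, then $$Q_p(a)\equiv\frac{a'(2a'+1)}{2a+1}p^2(-1)^{\frac{p-1}2}(-16)^{\langle a\rangle_p}\binom{2(\langle a\rangle_p-\frac{p-1}2)}{\langle a\rangle_p-\frac{p-1}2}^{-1}\Big(1+p\Big(\frac{2a'+1}{2a+1}+(2a'-1)q_p(2)-\frac{2a'+1}2\big(H_{p-1-\langle a\rangle_p}-H_{\langle a\rangle_p-\frac{p+1}2}\big)\Big)\Big)\pmod{p^4}.$$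
   Context: $\mathbb{Z}_p$ denotes the set of rational numbers whose denominator is not divisible by $p$; congruences are taken in $\mathbb{Z}_p$. For $a\in\mathbb{Z}_p$, $\langle a\rangle_p$ is the unique integer in $\{0,1,\dots,p-1\}$ with $a\equiv\langle a\rangle_p\pmod p$. The general binomial coefficient is $\binom a0=1$, $\binom ak=a(a-1)\cdots(a-k+1)/k!$ for $k\ge1$. $q_p(2)=(2^{p-1}-1)/p$. $H_0=H^{(2)}_0=0$, $H_n=\sum_{j=1}^n\frac1j$, $H^{(2)}_n=\sum_{j=1}^n\frac1{j^2}$. *)

(* Defs.v *)
From mathcomp Require Import all_boot all_order all_algebra.
From mathcomp Require Import ring.

Set Implicit Arguments.
Unset Strict Implicit.
Unset Printing Implicit Defensive.

Import Order.TTheory GRing.Theory Num.Theory.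

Local Open Scope ring_scope.

(* The ring Z_p of rationals whose denominator is prime to p (p prime).
   [denq] is the positive denominator in lowest terms. *)
Definition Zloc (p : nat) : {pred rat} :=
  fun x => ~~ (p%:Z %| denq x)%Z.

(* x = y (mod p^n Z_p), i.e., x - y = p^n z for some z in Z_p. *)
Definition Zloc_eqmod (p n : nat) (x y : rat) : bool :=
  (x - y) / p%:R ^+ n \in Zloc p.

(* <a>_p: as [find] returns an index in 0, 1, ..., p - 1, it is here the least
   r with a = r (mod p); see Zloc_resP and Zloc_res_unique. *)
Definition Zloc_res (p : nat) (a : rat) : nat :=
  find (fun r : nat => Zloc_eqmod p 1 a r%:R) (iota 0 p).

Definition binomQ (a : rat) (k : nat) : rat :=
  (\prod_(i < k) (a - i%:R)) / k`!%:R.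

Definition harmonic (n : nat) : rat := \sum_(1 <= j < n.+1) j%:R^-1.

Definition harmonic2 (n : nat) : rat := \sum_(1 <= j < n.+1) (j%:R ^+ 2)^-1.

Definition fermat_quotient2 (p : nat) : rat := (2 ^+ (p - 1) - 1) / p%:R.

Definition Qsum (p : nat) (a : rat) : rat :=
  \sum_(0 <= k < p) (a - (2 * k)%:R) * binomQ a k ^+ 4.

Lemma Zloc_frac (p : nat) (m d : int) :
  prime p -> ~~ (p%:Z %| d)%Z -> m%:Q / d%:Q \in Zloc p.
Proof.
move=> p_pr pNd; rewrite unfold_in; apply: contra pNd => /dvdz_trans; apply.
have [->|d0] := eqVneq d 0; first by rewrite dvdz0.
have E : numq (m%:Q / d%:Q) * d = m * denq (m%:Q / d%:Q).
  apply: (@intr_inj rat); rewrite !intrM numqE.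
  by rewrite mulrAC divfK // intr_eq0.
rewrite -(@Gauss_dvdzr _ (numq (m%:Q / d%:Q))); last first.
  by rewrite /coprimez /gcdz gcdnC; apply/eqP; congr Posz; apply/eqP; exact: coprime_num_den.
by rewrite E dvdz_mull.
Qed.

Lemma Zloc_resP (p : nat) (a : rat) : prime p -> a \in Zloc p ->
  (Zloc_res p a < p)%N /\ Zloc_eqmod p 1 a (Zloc_res p a)%:R.
Proof.
move=> p_pr pa; rewrite /Zloc_res; set P := (fun r : nat => _).
suff hP : has P (iota 0 p).
  have lt : (find P (iota 0 p) < p)%N by rewrite -[X in (_ < X)%N](size_iota 0) -has_find.
  by split=> //; move: (nth_find 0 hP); rewrite nth_iota.
have p0 : p%:Z != 0 by rewrite -lt0n prime_gt0.
set n := numq a; set d := denq a.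
have cop : coprimez d p.
  by rewrite coprimez_sym coprimezE prime_coprime //; move: pa; rewrite unfold_in dvdzE.
have /coprimezP[[u v] /= E] := cop.
have r0 : 0 <= (n * u %% p)%Z by rewrite modz_ge0.
have rp : (n * u %% p)%Z < p by rewrite ltz_pmod // ltz_nat prime_gt0.
apply/hasP; exists `|(n * u %% p)%Z|%N.
  by rewrite mem_iota add0n -ltz_nat gez0_abs.
rewrite /P /Zloc_eqmod expr1 [X in a - X]pmulrn gez0_abs //.
have -> : (a - (n * u %% p)%Z%:~R) / p%:R
        = (n * v + d * (n * u %/ p)%Z)%:Q / d%:Q.
  have pQ : p%:R != 0 :> rat by rewrite pmulrn intr_eq0.
  have dQ : d%:~R != 0 :> rat by rewrite intr_eq0 denq_neq0.
  apply: (mulIf pQ); apply: (mulIf dQ).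
  rewrite divfK // mulrAC divfK // mulrBl -numqE -/n.
  rewrite [p%:R]pmulrn -!intrM -intrB; congr (_%:~R).
  have -> : (n * u %% p)%Z = n * u - (n * u %/ p)%Z * p by rewrite {2}(divz_eq (n * u) p) addrC addKr.
  rewrite -[X in X - _]mulr1 -E; ring.
exact: Zloc_frac.
Qed.

Lemma Zloc_eqmod_nat_inj (p r s : nat) (a : rat) : prime p ->
  (r < p)%N -> (s < p)%N ->
  Zloc_eqmod p 1 a r%:R -> Zloc_eqmod p 1 a s%:R -> r = s.
Proof.
move=> p_pr rp sp; rewrite /Zloc_eqmod expr1.
set x := (a - _) / _; set y := (a - _) / _ => px py.
have pd : ~~ (p%:Z %| denq x * denq y)%Z.
  have {}px : ~~ (p%:Z %| denq x)%Z := px.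
  have {}py : ~~ (p%:Z %| denq y)%Z := py.
  by rewrite dvdzE abszM /= Euclid_dvdM // negb_or -![(p %| _)%N]/(p%:Z %| _)%Z px.
have pQ : p%:R != 0 :> rat by rewrite pnatr_eq0 -lt0n prime_gt0.
have E : (s%:Z - r%:Z) * (denq x * denq y)
       = p%:Z * (numq x * denq y - numq y * denq x).
  apply: (@intr_inj rat); rewrite !(intrM, intrB) !numqE -?pmulrn.
  have -> : s%:R - r%:R = p%:R * (x - y) :> rat.
    rewrite /x /y -mulrBl mulrC divfK //; ring.
  by ring.
have : (p%:Z %| s%:Z - r%:Z)%Z.
  have : (p%:Z %| (s%:Z - r%:Z) * (denq x * denq y))%Z by rewrite E dvdz_mulr.
  by rewrite Gauss_dvdzl // coprimezE prime_coprime // -dvdzE.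
rewrite -eqz_mod_dvd !modz_nat eqz_nat !modn_small //.
by move/eqP.
Qed.

Lemma Zloc_res_unique (p s : nat) (a : rat) : prime p -> a \in Zloc p ->
  (s < p)%N -> Zloc_eqmod p 1 a s%:R -> s = Zloc_res p a.
Proof.
move=> p_pr pa sp as_; have [rp ar] := Zloc_resP p_pr pa.
exact: Zloc_eqmod_nat_inj sp rp as_ ar.
Qed.

(* Main.v *)
(* Write r = <a>_p and t = a - r = p a'.  For r < k < p the factor binom(a,k)^4
   is divisible by p^4, so only the terms k <= r matter.  With w a primitive
   cube root of unity, replace the cube of
     binom(r+t,k) = prod_j (r+t-j)/(j+1)
   by
     prod_j ((r+t-j)^3 - t^3)/((j+1)^3 - t^3)
       = prod_j prod_i (r+t-j - w^i t)/(j+1 - w^i t).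
   The first and second power sums of t, w t, w^2 t vanish, so modulo p^4 this
   only adds t^3 (r-2k) binom(r,k)^4 h_k to the k-th term, where h_k = h_(r-k);
   these corrections cancel in the sum.  The new sum is a terminating
   very-well-poised 5F4(1), evaluated by Dougall's formula as
     (-1)^r t (t+1)_r (1+r+2t)_r / prod_(1<=j<=r) (j^2 + jt + t^2).
   If 2r < p, expand this in powers of t.  If 2r > p, the product (1+r+2t)_r
   contains the factor p + 2t = p(1+2a'), and the other factors are needed only
   modulo p^2, where Morley's congruence and the classical congruences for
   harmonic numbers modulo p apply. *)
Require Import Defs.
From mathcomp Require Import all_boot all_order all_algebra.
From mathcomp Require Import ring lra zify.

Import Order.TTheory GRing.Theory Num.Theory.

Local Open Scope ring_scope.

(** * Congruences in Z_p *)

(** With both fractions written over denominators prime to p, closure under ring operations reduces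
    to [Zloc_frac] and Euclid's lemma. *)
Lemma Zloc_repr {p : nat} {x : rat} : x \in Zloc p ->
  exists m d : int, ~~ (p%:Z %| d)%Z /\ d%:Q != 0 /\ x = m%:Q / d%:Q.
Proof.
move=> xp; exists (numq x), (denq x); split; first exact: xp.
by rewrite intr_eq0 denq_neq0 divq_num_den.
Qed.

Lemma prime_Ndvdz_mul {p : nat} {d e : int} : prime p ->
  ~~ (p%:Z %| d)%Z -> ~~ (p%:Z %| e)%Z -> ~~ (p%:Z %| d * e)%Z.
Proof. by move=> pp; rewrite !dvdzE abszM /= Euclid_dvdM // negb_or => -> ->. Qed.

Lemma ZlocD {p : nat} {x y : rat} : prime p ->
  x \in Zloc p -> y \in Zloc p -> x + y \in Zloc p.
Proof.
move=> pp /Zloc_repr[m [d [pd [d0 ->]]]] /Zloc_repr[n [e [pe [e0 ->]]]].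
have -> : m%:Q / d%:Q + n%:Q / e%:Q = (m * e + n * d)%:Q / (d * e)%:Q.
  by rewrite intrD !intrM; field; rewrite d0 e0.
exact/Zloc_frac/prime_Ndvdz_mul.
Qed.

Lemma ZlocM {p : nat} {x y : rat} : prime p ->
  x \in Zloc p -> y \in Zloc p -> x * y \in Zloc p.
Proof.
move=> pp /Zloc_repr[m [d [pd [d0 ->]]]] /Zloc_repr[n [e [pe [e0 ->]]]].
have -> : m%:Q / d%:Q * (n%:Q / e%:Q) = (m * n)%:Q / (d * e)%:Q.
  by rewrite !intrM; field; rewrite d0 e0.
exact/Zloc_frac/prime_Ndvdz_mul.
Qed.

Lemma Zloc_int {p : nat} (m : int) : prime p -> m%:~R \in Zloc p.
Proof.
move=> pp; have -> : m%:~R = m%:Q / 1%:Q by rewrite divr1.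
by apply: Zloc_frac => //; rewrite dvdzE dvdn1 neq_ltn prime_gt1 ?orbT.
Qed.

Lemma Zloc_nat {p : nat} (m : nat) : prime p -> m%:R \in Zloc p.
Proof. exact: (Zloc_int m). Qed.

Lemma Zloc0 {p : nat} : prime p -> 0 \in Zloc p.
Proof. exact: (Zloc_nat 0). Qed.

Lemma Zloc1 {p : nat} : prime p -> 1 \in Zloc p.
Proof. exact: (Zloc_nat 1). Qed.

Lemma ZlocN {p : nat} {x : rat} : prime p -> x \in Zloc p -> - x \in Zloc p.
Proof. by move=> pp xp; rewrite -mulN1r; apply: ZlocM => //; exact: (Zloc_int (-1)). Qed.

Lemma ZlocX {p : nat} {x : rat} (n : nat) : prime p -> x \in Zloc p -> x ^+ n \in Zloc p.
Proof.
move=> pp xp; elim: n => [|n IH]; first exact: Zloc1.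
by rewrite exprS; apply: ZlocM.
Qed.

Lemma Zloc_natV {p k : nat} : prime p -> (0 < k < p)%N -> k%:R^-1 \in Zloc p.
Proof.
move=> pp kp; have -> : k%:R^-1 = 1%:Q / k%:Q by rewrite mul1r.
by apply: Zloc_frac => //; rewrite dvdzE /= gtnNdvd //; case/andP: kp.
Qed.

Lemma Zloc_sum {p n : nat} {f : nat -> rat} : prime p ->
  (forall i, (i < n)%N -> f i \in Zloc p) -> \sum_(i < n) f i \in Zloc p.
Proof.
move=> pp; elim: n => [|n IH] fp; first by rewrite big_ord0 Zloc0.
by rewrite big_ord_recr /=; apply: ZlocD => //; auto.
Qed.

Lemma Zloc_prod {p n : nat} {f : nat -> rat} : prime p ->
  (forall i, (i < n)%N -> f i \in Zloc p) -> \prod_(i < n) f i \in Zloc p.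
Proof.
move=> pp; elim: n => [|n IH] fp; first by rewrite big_ord0 Zloc1.
by rewrite big_ord_recr /=; apply: ZlocM => //; auto.
Qed.

Create HintDb zloc.
#[local] Hint Resolve ZlocD ZlocM Zloc_nat Zloc0 Zloc1 ZlocN ZlocX : zloc.

(** As [0^-1 = 0], membership of x and of its inverse alone would admit 0. *)
Definition Zunit (p : nat) (x : rat) : bool :=
  [&& x != 0, x \in Zloc p & x^-1 \in Zloc p].

Lemma Zunit_neq0 {p : nat} {x : rat} : Zunit p x -> x != 0.
Proof. by case/and3P. Qed.

Lemma Zunit_int {p : nat} {x : rat} : Zunit p x -> x \in Zloc p.
Proof. by case/and3P. Qed.

Lemma ZunitV_int {p : nat} {x : rat} : Zunit p x -> x^-1 \in Zloc p.
Proof. by case/and3P. Qed.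

#[local] Hint Resolve Zunit_int ZunitV_int : zloc.

Lemma Zunit_nat {p k : nat} : prime p -> (0 < k < p)%N -> Zunit p k%:R.
Proof.
move=> pp kp; rewrite /Zunit Zloc_nat // Zloc_natV // pnatr_eq0 -lt0n.
by case/andP: kp => ->.
Qed.

Lemma ZunitM {p : nat} {x y : rat} : prime p ->
  Zunit p x -> Zunit p y -> Zunit p (x * y).
Proof.
move=> pp /and3P[x0 xp xV] /and3P[y0 yp yV].
by rewrite /Zunit mulf_neq0 // invfM !ZlocM.
Qed.

Lemma ZunitV {p : nat} {x : rat} : Zunit p x -> Zunit p x^-1.
Proof. by case/and3P=> x0 xp xV; rewrite /Zunit invr_eq0 invrK x0 xp xV. Qed.

Lemma ZunitX {p : nat} {x : rat} (n : nat) : prime p -> Zunit p x -> Zunit p (x ^+ n).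
Proof.
by move=> pp /and3P[x0 xp xV]; rewrite /Zunit expf_neq0 // -exprVn !ZlocX.
Qed.

Lemma Zunit_prod {p n : nat} {f : nat -> rat} : prime p ->
  (forall i, (i < n)%N -> Zunit p (f i)) -> Zunit p (\prod_(i < n) f i).
Proof.
move=> pp; elim: n => [|n IH] fp.
  by rewrite big_ord0 /Zunit oner_eq0 invr1 Zloc1.
by rewrite big_ord_recr /=; apply: ZunitM => //; auto.
Qed.

Lemma Zunit_fact {p n : nat} : prime p -> (n < p)%N -> Zunit p n`!%:R.
Proof.
move=> pp np; rewrite fact_prod big_add1 /= big_mkord natr_prod.
by apply: (@Zunit_prod p n (fun i => i.+1%:R)) => // i lt_in; apply: Zunit_nat; lia.
Qed.

Lemma primeQ_neq0 {p : nat} : prime p -> p%:R != 0 :> rat.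
Proof. by move=> pp; rewrite pnatr_eq0 -lt0n prime_gt0. Qed.

(** Turns a congruence into an equation with an explicit integral remainder, so that most
    congruences below are settled by a witness and [ring] or [field]. *)
Lemma ZeqmodP {p n : nat} {x y : rat} : prime p ->
  reflect (exists2 z, z \in Zloc p & x = y + p%:R ^+ n * z) (Zloc_eqmod p n x y).
Proof.
move=> pp; have p0 : p%:R ^+ n != 0 :> rat by rewrite expf_neq0 // primeQ_neq0.
apply: (iffP idP) => [xy | [z zp ->]].
  by exists ((x - y) / p%:R ^+ n) => //; field.
by rewrite /Zloc_eqmod (_ : _ / _ = z) //; field.
Qed.

Lemma Zeqmod_refl {p n : nat} (x : rat) : prime p -> Zloc_eqmod p n x x.
Proof. by move=> pp; rewrite /Zloc_eqmod subrr mul0r Zloc0. Qed.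

Lemma Zeqmod_sym {p n : nat} {x y : rat} : prime p ->
  Zloc_eqmod p n x y -> Zloc_eqmod p n y x.
Proof.
move=> pp /(ZeqmodP pp)[z zp ->]; apply/(ZeqmodP pp).
by exists (- z); rewrite ?ZlocN //; ring.
Qed.

Lemma Zeqmod_trans {p n : nat} {x y z : rat} : prime p ->
  Zloc_eqmod p n x y -> Zloc_eqmod p n y z -> Zloc_eqmod p n x z.
Proof.
move=> pp /(ZeqmodP pp)[u up ->] /(ZeqmodP pp)[v vp ->]; apply/(ZeqmodP pp).
by exists (v + u); rewrite ?ZlocD //; ring.
Qed.

Lemma ZeqmodD {p n : nat} {x y x' y' : rat} : prime p ->
  Zloc_eqmod p n x y -> Zloc_eqmod p n x' y' -> Zloc_eqmod p n (x + x') (y + y').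
Proof.
move=> pp /(ZeqmodP pp)[u up ->] /(ZeqmodP pp)[v vp ->]; apply/(ZeqmodP pp).
by exists (v + u); rewrite ?ZlocD //; ring.
Qed.

Lemma ZeqmodM {p n : nat} {x y x' y' : rat} : prime p ->
  y \in Zloc p -> y' \in Zloc p ->
  Zloc_eqmod p n x y -> Zloc_eqmod p n x' y' -> Zloc_eqmod p n (x * x') (y * y').
Proof.
move=> pp yp y'p /(ZeqmodP pp)[u up ->] /(ZeqmodP pp)[v vp ->]; apply/(ZeqmodP pp).
exists (y * v + y' * u + p%:R ^+ n * u * v); last by ring.
by auto 10 with zloc.
Qed.

Lemma ZeqmodZ {p n : nat} {c x y : rat} : prime p -> c \in Zloc p ->
  Zloc_eqmod p n x y -> Zloc_eqmod p n (c * x) (c * y).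
Proof.
move=> pp cp /(ZeqmodP pp)[u up ->]; apply/(ZeqmodP pp).
by exists (c * u); rewrite ?ZlocM //; ring.
Qed.

(** Each explicit power of p lowers the precision needed from the cofactor; the modulus p^4 is later
    split as 3+1, 1+3 and 2+2. *)
Lemma Zeqmod_pZ {p n : nat} (m : nat) {x y : rat} : prime p ->
  Zloc_eqmod p n x y -> Zloc_eqmod p (m + n) (p%:R ^+ m * x) (p%:R ^+ m * y).
Proof.
move=> pp /(ZeqmodP pp)[u up ->]; apply/(ZeqmodP pp).
by exists u => //; rewrite exprD; ring.
Qed.

Lemma ZeqmodX {p n : nat} {x y : rat} (k : nat) : prime p -> y \in Zloc p ->
  Zloc_eqmod p n x y -> Zloc_eqmod p n (x ^+ k) (y ^+ k).
Proof.
move=> pp yp xy; elim: k => [|k IH]; first exact: Zeqmod_refl.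
by rewrite !exprS; apply: ZeqmodM => //; apply: ZlocX.
Qed.

Lemma Zeqmod_sum {p n k : nat} {f g : nat -> rat} : prime p ->
  (forall i, (i < k)%N -> Zloc_eqmod p n (f i) (g i)) ->
  Zloc_eqmod p n (\sum_(i < k) f i) (\sum_(i < k) g i).
Proof.
move=> pp; elim: k => [|k IH] fg; first by rewrite !big_ord0 Zeqmod_refl.
by rewrite !big_ord_recr /=; apply: ZeqmodD => //; auto.
Qed.

Lemma Zeqmod_prod {p n k : nat} {f g : nat -> rat} : prime p ->
  (forall i, (i < k)%N -> g i \in Zloc p) ->
  (forall i, (i < k)%N -> Zloc_eqmod p n (f i) (g i)) ->
  Zloc_eqmod p n (\prod_(i < k) f i) (\prod_(i < k) g i).
Proof.
move=> pp; elim: k => [|k IH] gp fg; first by rewrite !big_ord0 Zeqmod_refl.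
rewrite !big_ord_recr /=; apply: ZeqmodM => //; auto.
by apply: Zloc_prod; auto.
Qed.

Lemma Zloc_Zeqmod {p n : nat} {x y : rat} : prime p ->
  y \in Zloc p -> Zloc_eqmod p n x y -> x \in Zloc p.
Proof. by move=> pp yp /(ZeqmodP pp)[u up ->]; auto with zloc. Qed.

Lemma Zunit_Zeqmod {p : nat} {x y : rat} : prime p ->
  Zunit p y -> Zloc_eqmod p 1 x y -> Zunit p x.
Proof.
move=> pp yu xy; have xp := Zloc_Zeqmod pp (Zunit_int yu) xy.
have Nx : ~~ (p%:Z %| numq x)%Z.
  (* If p divided the numerator of x = y + pz, then y/p = x/p - z would be integral; as y is a unit,
     so would be 1/p. *)
  apply/negP=> /dvdzP[k Ek]; have /(ZeqmodP pp)[z zp Exy] := xy.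
  have : 1 / p%:R \in Zloc p.
    have -> : 1 / p%:R = y^-1 * (k%:~R / (denq x)%:~R - z).
      have Ex : x = p%:R * (k%:~R / (denq x)%:~R).
        by rewrite -{1}(divq_num_den x) Ek intrM -pmulrn mulrCA mulrA.
      have -> : k%:~R / (denq x)%:~R = x / p%:R.
        by rewrite {2}Ex mulrAC divff ?mul1r // primeQ_neq0.
      by rewrite Exy; field; rewrite primeQ_neq0 // (Zunit_neq0 yu).
    apply: ZlocM => //; first exact: ZunitV_int.
    by apply: ZlocD; rewrite ?ZlocN //; apply: Zloc_frac.
  rewrite mul1r unfold_in (_ : denq _ = p) ?dvdzz //.
  by have := @denqVz p%:Z; rewrite -pmulrn; apply; rewrite -lt0n prime_gt0.
have x0 : x != 0 by apply: contraNneq Nx => ->; rewrite dvdz0.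
rewrite /Zunit x0 xp -(divq_num_den x) invf_div; exact: Zloc_frac.
Qed.

Lemma ZeqmodV {p n : nat} {x y : rat} : prime p -> (0 < n)%N ->
  Zunit p y -> Zloc_eqmod p n x y -> Zloc_eqmod p n x^-1 y^-1.
Proof.
move=> pp n0 yu xy.
have xu : Zunit p x.
  apply: (Zunit_Zeqmod pp yu); have /(ZeqmodP pp)[z zp ->] := xy.
  apply/(ZeqmodP pp); exists (p%:R ^+ n.-1 * z); first by auto with zloc.
  by rewrite mulrA -exprS prednK.
have /(ZeqmodP pp)[z zp Ex] := Zeqmod_sym pp xy; apply/(ZeqmodP pp).
exists (z * x^-1 * y^-1); first by auto with zloc.
by rewrite Ex; field; rewrite (Zunit_neq0 xu) -Ex (Zunit_neq0 yu).
Qed.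

(** * Dougall's terminating 5F4 summation *)

Definition poch {F : fieldType} (x : F) (k : nat) : F := \prod_(j < k) (x + j%:R).

Lemma poch0 {F : fieldType} (x : F) : poch x 0 = 1.
Proof. exact: big_ord0. Qed.

Lemma pochS {F : fieldType} (x : F) (k : nat) : poch x k.+1 = poch x k * (x + k%:R).
Proof. exact: big_ord_recr. Qed.

Lemma pochSl {F : fieldType} (x : F) (k : nat) : poch x k.+1 = x * poch (x + 1) k.
Proof.
rewrite /poch big_ord_recl /= addr0; congr (_ * _); apply: eq_bigr => i _.
by rewrite /bump /= add1n -addrA -natr1 (addrC 1).
Qed.

Lemma poch_shift {F : fieldType} (x : F) (k : nat) :
  x * poch (x + 1) k = poch x k * (x + k%:R).
Proof. by rewrite -pochSl pochS. Qed.

Lemma poch_neq0 {F : fieldType} (x : F) (k : nat) :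
  (forall i, (i < k)%N -> x + i%:R != 0) -> poch x k != 0.
Proof. by move=> xk; apply/prodf_neq0 => i _; apply: xk. Qed.

(* [wp_term a s q n] is the k-th term of the very-well-poised series with
   parameters a, c, d, -n, where s and q are the sum and the product of a - c
   and a - d; keeping only s and q avoids the cube roots of unity. *)
Definition wp_num {F : fieldType} (a s q : F) (k : nat) : F :=
  \prod_(j < k) ((a + j%:R) ^+ 2 - s * (a + j%:R) + q).

Definition wp_den {F : fieldType} (s q : F) (k : nat) : F :=
  \prod_(j < k) (j.+1%:R ^+ 2 + s * j.+1%:R + q).

Definition wp_term {F : fieldType} (a s q : F) (n k : nat) : F :=
  (a + 2 * k%:R) * poch a k * wp_num a s q k * poch (- n%:R) k /
  (k`!%:R * wp_den s q k * poch (1 + a + n%:R) k).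

(* The recurrence in n satisfied by the closed form, applied to the summand,
   is a difference in k (a Wilf-Zeilberger pair). *)
Lemma wp_telescope {F : numFieldType} (a s q : F) (n K : nat) :
  (forall j, (j.+1)%:R ^+ 2 + s * j.+1%:R + q != 0) ->
  (forall i, (i < K.+1 + n)%N -> a + 1 + i%:R != 0) ->
  \sum_(k < K.+1) ((n.+1%:R ^+ 2 + s * n.+1%:R + q) * wp_term a s q n.+1 k -
     (a + 1 + n%:R) * (1 - a + s + n%:R) * wp_term a s q n k) =
  (a + 1 + n%:R) * (poch a K.+1 * wp_num a s q K.+1 * poch (- n%:R) K /
    (K`!%:R * wp_den s q K * poch (1 + a + n%:R) K.+1)).
Proof.
move=> den0; elim: K => [|K IH] a0.
  rewrite big_ord1 /wp_term !pochS !poch0 /wp_num /wp_den !big_ord_recr !big_ord0 /=.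
  have := a0 n; rewrite !fact0 !addr0 => /(_ (ltnSn _)) an0.
  field.
  by rewrite (_ : 1 + a + n%:R = a + 1 + n%:R) ?an0 //; ring.
rewrite big_ord_recr /= IH; last by move=> i lt_i; apply: a0; lia.
have H1 : a + 1 + n%:R != 0 by apply: a0; lia.
have H2 : a + 1 + n%:R + K.+1%:R != 0 by rewrite -addrA -natrD; apply: a0; lia.
have H2' : a + 1 + n%:R + K%:R != 0 by rewrite -addrA -natrD; apply: a0; lia.
have HP : poch (1 + a + n%:R) K != 0.
  apply: poch_neq0 => i lt_i; rewrite (addrC 1) -addrA -natrD; apply: a0; lia.
have HD : wp_den s q K != 0 by apply/prodf_neq0 => i _; apply: den0.
(* The symbols of index n+1 and K+1 are expressed through those of index n and K. Once these are
   abstracted, a rational-function identity remains for [field]. *)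
have EnP : poch (- n.+1%:R) K.+1 = - n.+1%:R * poch (- n%:R) K :> F.
  by rewrite pochSl; congr (_ * poch _ _); rewrite -natr1; ring.
have EaP : poch (1 + a + n.+1%:R) K.+1 =
    poch (1 + a + n%:R) K * (a + 1 + n%:R + K%:R) * (a + 1 + n%:R + K.+1%:R)
    / (a + 1 + n%:R).
  have := poch_shift (1 + a + n%:R) K.+1; rewrite [X in _ = X * _]pochS.
  rewrite -[1 + a + n%:R + 1]addrA natr1 => E.
  apply: (mulfI (_ : 1 + a + n%:R != 0)); first by rewrite (addrC 1).
  by rewrite E; field.
have Wn k : wp_num a s q k.+1 = wp_num a s q k * ((a + k%:R) ^+ 2 - s * (a + k%:R) + q).
  exact: big_ord_recr.
have Wd : wp_den s q K.+1 = wp_den s q K * (K.+1%:R ^+ 2 + s * K.+1%:R + q).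
  exact: big_ord_recr.
rewrite /wp_term EnP EaP !(Wn _) Wd !pochS factS natrM.
have HK := den0 K.
have Hf : K`!%:R != 0 :> F by rewrite pnatr_eq0 -lt0n fact_gt0.
have HK1 : K.+1%:R != 0 :> F by rewrite pnatr_eq0.
move: HK HK1 H1 H2 H2' HP HD Hf; rewrite -!(natr1 K) -!(natr1 n).
move: (K%:R : F) (n%:R : F) (poch a K) (wp_num a s q K) (poch (- n%:R) K) (poch (1 + a + n%:R) K)
  (wp_den s q K) (K`!%:R : F) => k m A N B P D f.
move=> HK HK1 H1 H2 H2' HP HD Hf.
field.
rewrite HK HK1 H1 HP HD Hf /=.
rewrite (_ : 1 + a + m + k = a + 1 + m + k) ?H2' 
  1?(_ : 1 + a + m + (k + 1) = a + 1 + m + (k + 1)) ?H2 //; ring.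
Qed.

(** Induction on n: summing the Wilf-Zeilberger identity over all k <= n+1 kills the boundary term,
    and the resulting first-order recurrence is the one satisfied by the right-hand side. The second
    hypothesis keeps (1+a+n)_k nonzero for k <= n. *)
Lemma dougall {F : numFieldType} (a s q : F) (n : nat) :
  (forall j, (j.+1)%:R ^+ 2 + s * j.+1%:R + q != 0) ->
  (forall i, (i < 2 * n)%N -> a + 1 + i%:R != 0) ->
  \sum_(k < n.+1) wp_term a s q n k =
  a * poch (a + 1) n * poch (1 - a + s) n / wp_den s q n.
Proof.
move=> den0; elim: n => [|n IH] a0.
  by rewrite big_ord1 /wp_term /wp_num /wp_den !poch0 !big_ord0 fact0 /= !mulr1 mulr0 addr0 invr1 mulr1.
have poch_nat0 m : poch (- m%:R) m.+1 = 0 :> F by rewrite pochS addNr mulr0.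
(* With upper index K = n+1 the boundary term contains (-n)_(n+1) = 0; the same factor removes the
   extra term k = n+1 of the sum for n. *)
have := @wp_telescope F a s q n n.+1 den0.
rewrite poch_nat0 !(mulr0, mul0r) => /(_ _)/eqP.
rewrite sumrB subr_eq0 -!big_distrr [X in _ == _ * X]big_ord_recr /=.
have -> : wp_term a s q n n.+1 = 0 by rewrite /wp_term poch_nat0 mulr0 mul0r.
rewrite addr0 IH; last by move=> i lt_i; apply: a0; lia.
move=> H; have {}/H/eqP E : forall i : nat, (i < n.+2 + n)%N -> a + 1 + i%:R != 0.
  by move=> i lt_i; apply: a0; lia.
apply: (mulfI (den0 n)); rewrite E !pochS /wp_den big_ord_recr /=.
have HD : wp_den s q n != 0 by apply/prodf_neq0 => i _; apply: den0.
rewrite -/(wp_den s q n); field; by rewrite HD nat1r den0.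
Qed.

(** * Specialisation of Dougall's sum to the cubic ratio *)

Definition cubic_ratio (r : nat) (t : rat) (k : nat) : rat :=
  \prod_(j < k) (((r%:R + t - j%:R) ^+ 3 - t ^+ 3) / (j.+1%:R ^+ 3 - t ^+ 3)).

Lemma binomQS (a : rat) (k : nat) : binomQ a k.+1 = binomQ a k * ((a - k%:R) / k.+1%:R).
Proof.
rewrite /binomQ big_ord_recr /= factS natrM invfM -!mulrA.
by congr (_ * _); rewrite [RHS]mulrC -!mulrA.
Qed.

Lemma binomQ0 (a : rat) : binomQ a 0 = 1.
Proof. by rewrite /binomQ big_ord0 fact0 divr1. Qed.

Lemma binomQ_nat (n k : nat) : binomQ n%:R k = 'C(n, k)%:R.
Proof.
elim: k => [|k IH]; first by rewrite binomQ0 bin0.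
rewrite binomQS IH; have k0 : k.+1%:R != 0 :> rat by rewrite pnatr_eq0.
apply: (mulfI k0); rewrite -natrM mul_bin_left natrM mulrCA mulrC.
rewrite [k.+1%:R * _]mulrC divfK //.
by case: (leqP k n) => [/natrB-> // | lt_nk]; rewrite bin_small ?mulr0 ?mul0r.
Qed.

(** The factors on the left are the negatives of those on the right in reverse order. *)
Lemma poch_opp {F : fieldType} (x : F) (k : nat) :
  poch (- (k%:R + x)) k.+1 = (-1) ^+ k.+1 * poch x k.+1.
Proof.
elim: k => [|k IH]; first by rewrite !pochS !poch0 expr1; ring.
rewrite pochSl (_ : _ + 1 = - (k%:R + x)); last by rewrite -natr1; ring.
by rewrite IH [poch x k.+2]pochS [in RHS]exprS; ring.
Qed.

(** Completing the square. Positivity makes every factor of [wp_den t (t ^+ 2)] nonzero without any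
    p-adic argument. *)
Lemma quad_gt0 {F : realFieldType} (x t : F) :
  0 < x -> 0 < x ^+ 2 + t * x + t ^+ 2.
Proof.
move=> x0; rewrite (_ : _ + t ^+ 2 = (t + x / 2) ^+ 2 + 3 / 4 * x ^+ 2); last by field.
by rewrite ltr_wpDl ?sqr_ge0 // mulr_gt0 ?exprn_gt0 // divr_gt0 ?ltr0n.
Qed.

(** This is [dougall] with a = -(r+t), s = t, q = t^2, so that a-c and a-d are -wt and -w^2 t. The
    quadratic factors are (X^3 - t^3)/(X - t) with X = r+t-j above and X = j+1 below; the missing
    linear factors r-j and j+1-t come from (-r)_k and (1+a+r)_k. *)
Lemma cubic_dougall (r : nat) (t : rat) :
  t != 0 -> (forall i : nat, (0 < i <= r)%N -> i%:R - t != 0) ->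
  (forall i, (i < 2 * r)%N -> i.+1%:R - r%:R - t != 0) ->
  \sum_(k < r.+1) (r%:R + t - 2 * k%:R) * binomQ (r%:R + t) k * cubic_ratio r t k =
  (-1) ^+ r * t * poch (t + 1) r * poch (1 + r%:R + 2 * t) r / wp_den t (t ^+ 2) r.
Proof.
move=> t0 tN tD.
have den0 (j : nat) : j.+1%:R ^+ 2 + t * j.+1%:R + t ^+ 2 != 0.
  by rewrite gt_eqF // quad_gt0 // ltr0Sn.
have cube_den0 (j : nat) : (j < r)%N -> j.+1%:R ^+ 3 - t ^+ 3 != 0.
  move=> lt_jr; have -> : j.+1%:R ^+ 3 - t ^+ 3 = (j.+1%:R - t) * (j.+1%:R ^+ 2 + t * j.+1%:R + t ^+ 2) by ring.
  by rewrite mulf_neq0 ?den0 ?tN.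
have := @dougall _ (- (r%:R + t)) t (t ^+ 2) r den0.
have -> : - (r%:R + t) * poch (- (r%:R + t) + 1) r = - ((-1) ^+ r * t * poch (t + 1) r).
  by rewrite -pochSl poch_opp exprS pochSl; ring.
rewrite (_ : 1 - - (r%:R + t) + t = 1 + r%:R + 2 * t); last by ring.
have term k : (k <= r)%N -> wp_term (- (r%:R + t)) t (t ^+ 2) r k =
   - ((r%:R + t - 2 * k%:R) * binomQ (r%:R + t) k * cubic_ratio r t k).
  rewrite /wp_term => le_kr.
  have -> : - (r%:R + t) + 2 * k%:R = - (r%:R + t - 2 * k%:R) by ring.
  (* Only the recurrence in k of the binomial is kept; the induction then compares quotients of
     consecutive terms. *)
  move: (binomQS (r%:R + t)) (binomQ0 (r%:R + t)).
  move: (binomQ (r%:R + t)) => b binS bin0.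
  rewrite !mulNr -!mulrA; congr (- (_ * _)).
  elim: k le_kr => [_|k IH lt_kr].
    by rewrite bin0 /cubic_ratio /wp_num /wp_den !poch0 !big_ord0 fact0 ?(mulr1, mul1r, invr1).
  rewrite binS /cubic_ratio big_ord_recr /= -/(cubic_ratio r t k).
  rewrite mulrACA -IH ?(ltnW lt_kr) //.
  rewrite !pochS /wp_num /wp_den !big_ord_recr /=.
  rewrite -/(wp_num (- (r%:R + t)) t (t ^+ 2) k) -/(wp_den t (t ^+ 2) k).
  rewrite factS natrM.
  have HP : poch (1 + - (r%:R + t) + r%:R) k != 0.
    apply: poch_neq0 => i lt_i; rewrite (_ : _ + _ = i.+1%:R - t) ?tN ?(ltn_trans lt_i) // -natr1; ring.
  have HD : wp_den t (t ^+ 2) k != 0 by apply/prodf_neq0 => i _; apply: den0.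
  have Hf : k`!%:R != 0 :> rat by rewrite pnatr_eq0 -lt0n fact_gt0.
  have Hk : k.+1%:R != 0 :> rat by rewrite pnatr_eq0.
  have := cube_den0 k lt_kr; have := den0 k; have := tN k.+1 lt_kr; move: HP HD Hf Hk.
  rewrite -!(natr1 k).
  move: (poch _ k) (poch _ k) (poch _ k) (wp_num _ _ _ _) (wp_den _ _ _) => A B C N D.
  move=> HP HD Hf Hk H1 H2 H3; field.
  rewrite HP HD Hf Hk H2 H3 (_ : 1 - (r%:R + t) + r%:R + k%:R = k%:R + 1 - t) ?H1 //; ring.
move=> H; have {}/H H : forall i : nat, (i < 2 * r)%N -> - (r%:R + t) + 1 + i%:R != 0.
  by move=> i lt_i; rewrite (_ : _ + _ = i.+1%:R - r%:R - t) ?tD // -natr1; ring.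
apply: oppr_inj; transitivity (\sum_(k < r.+1) wp_term (- (r%:R + t)) t (t ^+ 2) r k).
  by rewrite -sumrN; apply: eq_bigr => k _; rewrite term // -ltnS.
by rewrite H !mulNr.
Qed.

(** * Reduction of the sum to a closed form *)

Lemma Zloc_p {p : nat} : prime p -> p%:R \in Zloc p.
Proof. exact: Zloc_nat. Qed.

Lemma Zeqmod_addp {p : nat} {z : rat} (x : rat) : prime p -> z \in Zloc p ->
  Zloc_eqmod p 1 (x + p%:R * z) x.
Proof. by move=> pp zp; apply/(ZeqmodP pp); exists z; rewrite ?expr1. Qed.

Lemma Zunit_addp {p : nat} {x z : rat} : prime p -> Zunit p x -> z \in Zloc p ->
  Zunit p (x + p%:R * z).
Proof. move=> pp xu zp; apply: (Zunit_Zeqmod pp xu); exact: Zeqmod_addp. Qed.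

Lemma Zeqmod_binomQ {p n k : nat} {a b : rat} : prime p -> b \in Zloc p -> (k < p)%N ->
  Zloc_eqmod p n a b -> Zloc_eqmod p n (binomQ a k) (binomQ b k).
Proof.
move=> pp bp kp ab; rewrite /binomQ.
have dp : k`!%:R^-1 \in Zloc p by apply: ZunitV_int; apply: Zunit_fact.
rewrite mulrC [X in Zloc_eqmod _ _ _ X]mulrC; apply: ZeqmodZ => //.
apply: (@Zeqmod_prod p n k (fun i => a - i%:R) (fun i => b - i%:R)) => // i _.
  by auto with zloc.
by apply: ZeqmodD => //; apply: Zeqmod_refl.
Qed.

(** The reversal k -> r-k negates r-2k and fixes f, so the sum equals its own negative. *)
Lemma sum_antisym {F : numFieldType} (r : nat) (f : nat -> F) :
  (forall k, (k <= r)%N -> f (r - k)%N = f k) ->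
  \sum_(k < r.+1) (r%:R - 2 * k%:R) * f k = 0.
Proof.
move=> fsym; set S := (X in X = 0).
suff E : S = - S by apply/eqP; rewrite -[_ == 0](mulrn_eq0 S 2) mulr2n {2}E subrr.
rewrite {1}/S (reindex_inj rev_ord_inj) /= -sumrN; apply: eq_bigr => k _.
have le_kr : (k <= r)%N by rewrite -ltnS.
by rewrite subSS fsym // natrB //; ring.
Qed.

(** The correction h_k: modulo p, minus the coefficient of t^3 when [cubic_ratio r t k] is divided
    by the cube of the binomial. *)
Definition invcube_diff (r k : nat) : rat :=
  \sum_(j < k) ((((r - j)%:R : rat) ^+ 3)^-1 - (j.+1%:R ^+ 3)^-1).

(** With H the harmonic numbers of order 3, h_k = H_r - H_(r-k) - H_k, which is symmetric in k and
    r-k. *)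
Lemma invcube_diff_sym {r k : nat} : (k <= r)%N ->
  invcube_diff r (r - k) = invcube_diff r k.
Proof.
move=> le_kr; pose H n : rat := \sum_(j < n) (j.+1%:R ^+ 3)^-1.
have HS n : H n.+1 = H n + (n.+1%:R ^+ 3)^-1 by exact: big_ord_recr.
suff E m : (m <= r)%N -> invcube_diff r m = H r - H (r - m)%N - H m.
  by rewrite !E ?leq_subr // subKn //; ring.
elim: m => [_|m IH lt_mr].
  by rewrite /invcube_diff subn0 /H !big_ord0; ring.
rewrite /invcube_diff big_ord_recr /= -/(invcube_diff r m) IH ?(ltnW lt_mr) //.
by rewrite HS -(subnSK lt_mr) HS; ring.
Qed.

(* As the factor t^3 is divisible by p^3, e matters only modulo p. *)
Lemma cubic_ratioE {p r k : nat} {z : rat} : prime p -> (r < p)%N -> z \in Zloc p ->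
  (k <= r)%N ->
  exists2 e, Zloc_eqmod p 1 e (invcube_diff r k) /\ e \in Zloc p &
    cubic_ratio r (p%:R * z) k =
    binomQ (r%:R + p%:R * z) k ^+ 3 * (1 - (p%:R * z) ^+ 3 * e).
Proof.
move=> pp rp zp; set t := p%:R * z; have tp : t \in Zloc p by rewrite ZlocM ?Zloc_p.
elim: k => [_|k IH lt_kr].
  exists 0; first by rewrite /invcube_diff big_ord0 Zeqmod_refl ?Zloc0.
  by rewrite /cubic_ratio binomQ0 big_ord0; ring.
have [e [ek ep] Ek] := IH (ltnW lt_kr).
set x0 : rat := (r - k)%:R; set m : rat := k.+1%:R.
have x0u : Zunit p x0 by apply: Zunit_nat; lia.
have mu : Zunit p m by apply: Zunit_nat; lia.
set X := r%:R + t - k%:R.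
have EX : X = x0 + p%:R * z by rewrite /X /x0 natrB ?(ltnW lt_kr) // -/t; ring.
have Xu : Zunit p X by rewrite EX; apply: Zunit_addp.
set M := m ^+ 3 - t ^+ 3.
have EM : M = m ^+ 3 + p%:R * (- (z * t ^+ 2)) by rewrite /M /t; ring.
have wp : - (z * t ^+ 2) \in Zloc p by auto with zloc.
have Mu : Zunit p M by rewrite EM; apply: Zunit_addp => //; apply: ZunitX.
(* Chosen so that the new factor (X^3 - t^3)/(m^3 - t^3) equals (X/m)^3 (1 - t^3 f) exactly. *)
set f := ((X ^+ 3)^-1 - (m ^+ 3)^-1) * (m ^+ 3 * M^-1).
have f0 : Zloc_eqmod p 1 f ((x0 ^+ 3)^-1 - (m ^+ 3)^-1).
  rewrite -[X in Zloc_eqmod p 1 _ X]mulr1 -(divff (expf_neq0 3 (Zunit_neq0 mu))).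
  have x3 := ZunitX 3 pp x0u; have m3 := ZunitX 3 pp mu.
  apply: ZeqmodM => //; rewrite ?ZlocM ?ZlocD ?ZlocN //; auto with zloc.
    apply: ZeqmodD => //; last exact: Zeqmod_refl.
    apply: ZeqmodV => //; apply: ZeqmodX => //; first exact: Zunit_int.
    by rewrite EX; apply: Zeqmod_addp.
  apply: ZeqmodZ => //; first exact: Zunit_int.
  by apply: ZeqmodV => //; rewrite EM; apply: Zeqmod_addp.
have fp : f \in Zloc p.
  apply: (Zloc_Zeqmod pp _ f0).
  have x3 := ZunitX 3 pp x0u; have m3 := ZunitX 3 pp mu; auto with zloc.
(* From (1 - t^3 e)(1 - t^3 f) = 1 - t^3 (e + f - t^3 e f). *)
exists (e + f - t ^+ 3 * e * f).
  split; last by auto 10 with zloc.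
  rewrite /invcube_diff big_ord_recr /= -/(invcube_diff r k) -/x0 -/m.
  rewrite -[X in Zloc_eqmod p 1 _ X]addr0; apply: ZeqmodD => //; first exact: ZeqmodD.
  apply/(ZeqmodP pp); exists (- (z * t ^+ 2 * e * f)); first by auto 10 with zloc.
  by rewrite expr1 /t; ring.
rewrite /cubic_ratio big_ord_recr /= -/(cubic_ratio r t k) Ek binomQS -/X -/m -/M.
move: (binomQ _ k) => b.
have key (Y n s : rat) : Y != 0 -> n != 0 -> n ^+ 3 - s ^+ 3 != 0 ->
    b ^+ 3 * (1 - s ^+ 3 * e) * ((Y ^+ 3 - s ^+ 3) / (n ^+ 3 - s ^+ 3)) =
    let g := ((Y ^+ 3)^-1 - (n ^+ 3)^-1) * (n ^+ 3 * (n ^+ 3 - s ^+ 3)^-1) in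
    (b * (Y / n)) ^+ 3 * (1 - s ^+ 3 * (e + g - s ^+ 3 * e * g)).
  by move=> Y0 n0 d0 /=; field; rewrite Y0 n0 d0.
exact: (key X m t (Zunit_neq0 Xu) (Zunit_neq0 mu) (Zunit_neq0 Mu)).
Qed.

Lemma Qsum_eqmod_closed {p r : nat} {t z : rat} : prime p -> (r < p)%N -> z \in Zloc p ->
  t = p%:R * z ->
  Zloc_eqmod p 4 (Qsum p (r%:R + t))
    ((-1) ^+ r * t * poch (t + 1) r * poch (1 + r%:R + 2 * t) r / wp_den t (t ^+ 2) r).
Proof.
move=> pp rp zp Et; have tp : t \in Zloc p by rewrite Et ZlocM ?Zloc_p.
have rt : Zloc_eqmod p 1 (r%:R + t) r%:R by rewrite Et; apply: Zeqmod_addp.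
pose f k := (r%:R + t - 2 * k%:R) * binomQ (r%:R + t) k ^+ 4.
have binp k : (k < p)%N -> binomQ (r%:R + t) k \in Zloc p.
  move=> kp; apply: (Zloc_Zeqmod pp _ (Zeqmod_binomQ (n := 1) pp _ kp rt)).
    by rewrite binomQ_nat Zloc_nat.
  exact: Zloc_nat.
have bin1 k : (k < p)%N -> Zloc_eqmod p 1 (binomQ (r%:R + t) k) 'C(r, k)%:R.
  move=> kp; rewrite -binomQ_nat; apply: Zeqmod_binomQ => //; exact: Zloc_nat.
have trunc : Zloc_eqmod p 4 (Qsum p (r%:R + t)) (\sum_(k < r.+1) f k).
  rewrite /Qsum big_mkord (big_ord_widen p) // [X in Zloc_eqmod _ _ _ X]big_mkcond /=.
  apply: (@Zeqmod_sum p 4 p (fun k => (r%:R + t - (2 * k)%:R) * binomQ (r%:R + t) k ^+ 4)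
    (fun k => if (k < r.+1)%N then f k else 0)) => // k kp.
  case: ltnP => [_|lt_rk]; first by rewrite natrM; apply: Zeqmod_refl.
  have := bin1 k kp; rewrite bin_small // => /(ZeqmodP pp)[b bp ->].
  apply/(ZeqmodP pp); exists ((r%:R + t - (2 * k)%:R) * b ^+ 4); last by ring.
  by auto 10 with zloc.
apply: (Zeqmod_trans pp trunc).
(* The summation formula assumes t nonzero. For t = 0 the closed form vanishes by its factor t, and
   the sum vanishes by antisymmetry. *)
have [t0|t0] := eqVneq t 0.
  rewrite t0 mulr0 !mul0r (_ : \sum_(k < _) _ = 0) ?Zeqmod_refl //.
  have /= S0 := @sum_antisym rat r (fun k => 'C(r, k)%:R ^+ 4).
  rewrite -[RHS]S0 => [|k le_kr]; last by rewrite bin_sub.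
  by apply: eq_bigr => k _; rewrite /f t0 addr0 binomQ_nat.
rewrite -cubic_dougall //; first last.
(* As i+1-r lies strictly between -p and p, the expression is a unit unless i+1 = r, where it is
   -t. *)
- move=> i lt_i; rewrite (_ : - t = p%:R * - z); last by rewrite mulrN Et.
  case: (ltngtP i.+1 r) => [lt_ir|lt_ri|->]; last by rewrite subrr add0r mulrN -Et oppr_eq0.
    apply: (@Zunit_neq0 p); apply: Zunit_addp; rewrite ?ZlocN //.
    have : Zunit p (r - i.+1)%:R by apply: Zunit_nat; lia.
    move=> /(ZunitM pp) h; rewrite (_ : _ - _ = (r - i.+1)%:R * -1).
      by apply: h; rewrite /Zunit invrN invr1 oppr_eq0 oner_eq0 !ZlocN ?Zloc1.
    by rewrite natrB ?(ltnW lt_ir) //; ring.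
  apply: (@Zunit_neq0 p); apply: Zunit_addp; rewrite ?ZlocN //.
  by rewrite -natrB ?(ltnW lt_ri) //; apply: Zunit_nat; lia.
- move=> i lt_i; rewrite (_ : - t = p%:R * - z); last by rewrite mulrN Et.
  by apply: (@Zunit_neq0 p); apply: Zunit_addp; rewrite ?ZlocN //; apply: Zunit_nat; lia.
pose h k : rat := 'C(r, k)%:R ^+ 4 * invcube_diff r k.
have h0 : \sum_(k < r.+1) (r%:R - 2 * k%:R) * h k = 0.
  by apply: sum_antisym => k le_kr; rewrite /h bin_sub // invcube_diff_sym.
have hp k : (k <= r)%N -> invcube_diff r k \in Zloc p.
  move=> le_kr; apply: (@Zloc_sum p k (fun j => (((r - j)%:R ^+ 3)^-1 - (j.+1%:R ^+ 3)^-1))) => // i lt_ik.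
  have u1 : Zunit p (r - i)%:R by apply: Zunit_nat; lia.
  have u2 : Zunit p i.+1%:R by apply: Zunit_nat; lia.
  by have u3 := ZunitX 3 pp u1; have u4 := ZunitX 3 pp u2; auto with zloc.
(* Adding this zero sum to the right-hand side makes the congruence hold term by term. *)
have addh0 (x : rat) : x = x + t ^+ 3 * \sum_(k < r.+1) (r%:R - 2 * k%:R) * h k.
  by rewrite h0 mulr0 addr0.
rewrite [X in Zloc_eqmod _ _ _ X]addh0 big_distrr -big_split /=.
apply: (@Zeqmod_sum p 4 r.+1 f (fun k => (r%:R + t - 2 * k%:R) * binomQ (r%:R + t) k *
   cubic_ratio r t k + t ^+ 3 * ((r%:R - 2 * k%:R) * h k))) => // k lt_kr.
have kp : (k < p)%N by apply: leq_trans rp.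
have [e [ek ep]] := cubic_ratioE pp rp zp (lt_kr : (k <= r)%N); rewrite -Et => ->.
have -> : f k = (r%:R + t - 2 * k%:R) * binomQ (r%:R + t) k *
    (binomQ (r%:R + t) k ^+ 3 * (1 - t ^+ 3 * e)) +
    p%:R ^+ 3 * (z ^+ 3 * ((r%:R + t - 2 * k%:R) * (binomQ (r%:R + t) k ^+ 4 * e))).
  rewrite [p%:R ^+ 3 * _]mulrA -exprMn -Et /f.
  by move: (binomQ _ k) => b; ring.
rewrite /h [t ^+ 3 * ((r%:R - _) * _)](_ : _ = p%:R ^+ 3 *
  (z ^+ 3 * ((r%:R - 2 * k%:R) * ('C(r, k)%:R ^+ 4 * invcube_diff r k)))); last by rewrite {1}Et exprMn -!mulrA.
apply: ZeqmodD => //; first exact: Zeqmod_refl.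
apply: (Zeqmod_pZ 3) => //; apply: ZeqmodZ; rewrite ?ZlocX //.
have kN : (k <= r)%N by [].
apply: ZeqmodM => //; [by auto with zloc | by have := hp k kN; auto with zloc | | ].
  by apply: ZeqmodD => //; exact: Zeqmod_refl.
apply: ZeqmodM => //; [by auto with zloc | exact: hp |].
by apply: ZeqmodX => //; [exact: Zloc_nat | exact: bin1].
Qed.

(** * Expansions in harmonic numbers *)

Lemma harmonic0 : harmonic 0 = 0.
Proof. by rewrite /harmonic big_geq. Qed.

Lemma harmonicS (n : nat) : harmonic n.+1 = harmonic n + n.+1%:R^-1.
Proof. by rewrite /harmonic big_nat_recr. Qed.

Lemma harmonic2_0 : harmonic2 0 = 0.
Proof. by rewrite /harmonic2 big_geq. Qed.

Lemma harmonic2S (n : nat) : harmonic2 n.+1 = harmonic2 n + (n.+1%:R ^+ 2)^-1.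
Proof. by rewrite /harmonic2 big_nat_recr. Qed.

Lemma harmonic_shift (c k : nat) :
  \sum_(j < k) ((c + j).+1%:R : rat)^-1 = harmonic (c + k) - harmonic c.
Proof.
elim: k => [|k IH]; first by rewrite big_ord0 addn0 subrr.
by rewrite big_ord_recr /= IH addnS harmonicS; ring.
Qed.

Lemma harmonic2_shift (c k : nat) :
  \sum_(j < k) (((c + j).+1%:R : rat)^-1) ^+ 2 = harmonic2 (c + k) - harmonic2 c.
Proof.
elim: k => [|k IH]; first by rewrite big_ord0 addn0 subrr.
by rewrite big_ord_recr /= IH addnS harmonic2S exprVn; ring.
Qed.

Lemma fact_shift (c k : nat) :
  \prod_(j < k) ((c + j).+1%:R : rat) = (c + k)`!%:R / c`!%:R.
Proof.
have c0 : c`!%:R != 0 :> rat by rewrite pnatr_eq0 -lt0n fact_gt0.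
elim: k => [|k IH]; first by rewrite big_ord0 addn0 divff.
by rewrite big_ord_recr /= IH addnS factS natrM; ring.
Qed.

Lemma harmonicE (n : nat) : harmonic n = \sum_(j < n) (j.+1%:R)^-1.
Proof. by rewrite /harmonic big_add1 big_mkord. Qed.

Lemma factR_prod (n : nat) : n`!%:R = \prod_(j < n) (j.+1%:R : rat).
Proof. by rewrite fact_prod big_add1 /= big_mkord natr_prod. Qed.

Lemma Zloc_harmonic {p n : nat} : prime p -> (n < p)%N -> harmonic n \in Zloc p.
Proof.
move=> pp np; rewrite harmonicE; apply: (@Zloc_sum p n (fun j => j.+1%:R^-1)) => // j jn.
by apply: Zloc_natV => //; lia.
Qed.

Lemma Zloc_harmonic2 {p n : nat} : prime p -> (n < p)%N -> harmonic2 n \in Zloc p.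
Proof.
move=> pp; elim: n => [|n IH] np; first by rewrite harmonic2_0 Zloc0.
rewrite harmonic2S -exprVn; apply: ZlocD => //; first by apply: IH; lia.
by apply: ZlocX => //; apply: Zloc_natV => //; lia.
Qed.

Lemma Zunit2 {p : nat} : prime p -> odd p -> Zunit p 2.
Proof. by move=> pp po; apply: Zunit_nat => //; have := prime_gt1 pp; case: p po pp => [|[|[]]]. Qed.

Lemma Zeqmod_le {p n : nat} (k : nat) {x y : rat} : prime p ->
  Zloc_eqmod p (n + k) x y -> Zloc_eqmod p n x y.
Proof.
move=> pp /(ZeqmodP pp)[z zp ->]; apply/(ZeqmodP pp).
by exists (p%:R ^+ k * z); rewrite ?ZlocM ?ZlocX ?Zloc_p // exprD; ring.
Qed.

(** By Newton's identity (S^2 - S2)/2 is the second elementary symmetric function of the 1/f_j;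
    oddness of p makes the division by 2 harmless. *)
Lemma prod_addp3 {p k : nat} {f : nat -> rat} {z : rat} : prime p -> odd p ->
  (forall j, (j < k)%N -> Zunit p (f j)) -> z \in Zloc p ->
  let S := \sum_(j < k) (f j)^-1 in
  let S2 := \sum_(j < k) ((f j)^-1) ^+ 2 in
  (Zloc_eqmod p 3 (\prod_(j < k) (f j + p%:R * z))
    ((\prod_(j < k) f j) *
     (1 + p%:R * z * S + (p%:R * z) ^+ 2 * ((S ^+ 2 - S2) / 2)))) : Prop.
Proof.
move=> pp po fu zp /=; have u2 := Zunit2 pp po.
elim: k fu => [|k IH] fu.
  by rewrite !big_ord0 expr0n subrr mul0r !mulr0 !addr0 mulr1 Zeqmod_refl.
have {}IH := IH (fun j jk => fu j (ltnW jk)).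
rewrite !big_ord_recr /=; set S := \sum_(j < k) _; set S2 := \sum_(j < k) _.
set P := \prod_(j < k) f j.
have Sp : S \in Zloc p.
  by apply: (@Zloc_sum p k (fun j => (f j)^-1)) => // j jk; apply/ZunitV_int/fu/ltnW.
have S2p : S2 \in Zloc p.
  apply: (@Zloc_sum p k (fun j => (f j)^-1 ^+ 2)) => // j jk.
  by apply: ZlocX => //; apply/ZunitV_int/fu/ltnW.
have Pp : P \in Zloc p.
  by apply: Zloc_prod => // j jk; apply/Zunit_int/fu/ltnW.
have xu := fu k (leqnn _); move: xu IH; rewrite -/S -/S2 -/P; move: (f k) => x xu IH.
have tp : p%:R * z \in Zloc p by rewrite ZlocM ?Zloc_p.
have i2 := ZunitV_int u2.
apply: (Zeqmod_trans pp (y := P *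
     (1 + p%:R * z * S + (p%:R * z) ^+ 2 * ((S ^+ 2 - S2) / 2)) * (x + p%:R * z))).
  apply: ZeqmodM => //; last exact: Zeqmod_refl.
    by auto 12 with zloc.
  by auto with zloc.
apply/(ZeqmodP pp); exists (P * z ^+ 3 * ((S ^+ 2 - S2) / 2)).
  by auto 12 with zloc.
by field; rewrite (Zunit_neq0 xu).
Qed.

(** The factor at m is (m+t)/(m^2+mt+t^2) = (m^2-t^2)/(m^3-t^3), which is (1/m)(1 - t^2/m^2) modulo
    p^3: no linear term in t arises. *)
Lemma poch_div_den {p r : nat} {t z : rat} : prime p -> (r < p)%N -> z \in Zloc p ->
  t = p%:R * z ->
  Zloc_eqmod p 3 (poch (t + 1) r / wp_den t (t ^+ 2) r)
    ((r`!%:R)^-1 * (1 - t ^+ 2 * harmonic2 r)).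
Proof.
move=> pp rp zp Et; have tp : t \in Zloc p by rewrite Et ZlocM ?Zloc_p.
elim: r rp => [|r IH] rp.
  rewrite poch0 /wp_den big_ord0 /harmonic2 big_geq // mulr0 subr0 fact0.
  by rewrite invr1 !mulr1 Zeqmod_refl.
have {}IH := IH (ltnW rp).
have mu : Zunit p (r.+1%:R) by apply: Zunit_nat; lia.
have Hp := Zloc_harmonic2 pp (ltnW rp).
have fu := Zunit_fact pp (ltnW rp).
set m : rat := r.+1%:R in mu *; set D := m ^+ 3 - t ^+ 3.
have ED : D = m ^+ 3 + p%:R * (- (z * t ^+ 2)) by rewrite /D Et; ring.
have Du : Zunit p D.
  by rewrite ED; apply: Zunit_addp; [|exact: ZunitX|auto with zloc].
set Q := m ^+ 2 + t * m + t ^+ 2.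
have EQ : Q * (m - t) = D by rewrite /Q /D; ring.
have Q0 : Q != 0 by apply: contraNneq (Zunit_neq0 Du) => Q0; rewrite -EQ Q0 mul0r.
have d0 : m - t != 0 by apply: contraNneq (Zunit_neq0 Du) => d0; rewrite -EQ d0 mulr0.
have -> : poch (t + 1) r.+1 / wp_den t (t ^+ 2) r.+1 =
    poch (t + 1) r / wp_den t (t ^+ 2) r * ((m ^+ 2 - t ^+ 2) * D^-1).
  rewrite pochS /wp_den big_ord_recr /= -/(wp_den t (t ^+ 2) r) -/m -/Q -EQ.
  rewrite (_ : t + 1 + r%:R = m + t); last by rewrite /m -natr1; ring.
  have HD : wp_den t (t ^+ 2) r != 0.
    apply/prodf_neq0 => j _; have xj : 0 < j.+1%:R :> rat by rewrite ltr0Sn.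
    by rewrite gt_eqF // quad_gt0.
  have key (P W q x y : rat) : W != 0 -> q != 0 -> x - y != 0 ->
      P * (x + y) / (W * q) = P / W * ((x ^+ 2 - y ^+ 2) / (q * (x - y))).
    by move=> W0 q0 xy0; field; rewrite W0 q0 xy0.
  exact: key.
apply: (Zeqmod_trans pp (y := ((r`!%:R)^-1 * (1 - t ^+ 2 * harmonic2 r)) *
    ((m ^+ 2 - t ^+ 2) * (m ^+ 3)^-1))).
  have m3 := ZunitX 3 pp mu.
  apply: ZeqmodM => //; [by auto 10 with zloc | by auto 10 with zloc |].
  apply: ZeqmodZ; [by [] | by auto with zloc |].
  apply: ZeqmodV => //; apply/(ZeqmodP pp); exists (- z ^+ 3); first by auto with zloc.
  by rewrite /D Et; ring.
apply/(ZeqmodP pp).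
exists ((r`!%:R)^-1 * m^-1 * p%:R * z ^+ 4 * harmonic2 r * m^-1 ^+ 2); first by auto 20 with zloc.
rewrite factS natrM harmonic2S -/m Et.
move: (harmonic2 r) (r`!%:R : rat) (p%:R : rat) (Zunit_neq0 fu) (Zunit_neq0 mu) => h f q f0.
by clearbody m => m0; field; rewrite f0 m0.
Qed.

Lemma poch_expand {p c k : nat} {z : rat} : prime p -> odd p -> z \in Zloc p ->
  (c + k < p)%N ->
  Zloc_eqmod p 3 (poch (1 + c%:R + p%:R * z) k)
    ((c + k)`!%:R / c`!%:R *
     (1 + p%:R * z * (harmonic (c + k) - harmonic c) +
      (p%:R * z) ^+ 2 * (((harmonic (c + k) - harmonic c) ^+ 2 -
         (harmonic2 (c + k) - harmonic2 c)) / 2))).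
Proof.
move=> pp po zp ckp.
have /(_ pp po _ zp) := @prod_addp3 p k (fun j => (c + j).+1%:R) z.
rewrite /= harmonic_shift harmonic2_shift fact_shift => H.
rewrite (_ : poch _ k = \prod_(j < k) ((c + j).+1%:R + p%:R * z)); last first.
  by apply: eq_bigr => j _; rewrite -natr1 natrD; ring.
by apply: H => j jk; apply: Zunit_nat; lia.
Qed.

(** The factor t of the closed form supplies one p, so the rest is needed modulo p^3. As 2r < p, all
    factors of (1+r+2t)_r are units and [poch_expand] applies with c = k = r. *)
Lemma Qsum_lt_half {p r : nat} {a' : rat} : prime p -> odd p -> (2 * r < p)%N ->
  a' \in Zloc p ->
  Zloc_eqmod p 4 (Qsum p (r%:R + p%:R * a'))
    (a' * p%:R * (-1) ^+ r * 'C(2 * r, r)%:R *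
        (1 + 2 * a' * p%:R * (harmonic (2 * r) - harmonic r)
           + a' ^+ 2 * p%:R ^+ 2 *
             (2 * (harmonic (2 * r) - harmonic r) ^+ 2
              - 2 * harmonic2 (2 * r) + harmonic2 r))).
Proof.
move=> pp po r2p zp; have rp : (r < p)%N by lia.
apply: (Zeqmod_trans pp (Qsum_eqmod_closed pp rp zp erefl)).
have tp : p%:R * a' \in Zloc p by rewrite ZlocM ?Zloc_p.
have C1 := poch_div_den pp rp zp erefl.
have r2p' : (r + r < p)%N by lia.
have z2p : 2 * a' \in Zloc p by rewrite ZlocM ?Zloc_nat.
have C2 := poch_expand pp po z2p r2p'.
have -> : 1 + r%:R + 2 * (p%:R * a') = 1 + r%:R + p%:R * (2 * a') by ring.
move: C2; rewrite addnn -mul2n => C2.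
have EC : (2 * r)`!%:R = 'C(2 * r, r)%:R * r`!%:R * r`!%:R :> rat.
  have le_r2 : (r <= 2 * r)%N by lia.
  have E2 : (2 * r - r = r)%N by lia.
  by rewrite -!natrM -mulnA; congr (_%:R); rewrite -{1}(bin_fact le_r2) E2.
have fu := Zunit_fact pp rp.
have i2 := ZunitV_int (Zunit2 pp po).
have [H1 H2 H3 H4] : [/\ harmonic r \in Zloc p, harmonic (2 * r) \in Zloc p,
    harmonic2 r \in Zloc p & harmonic2 (2 * r) \in Zloc p].
  by rewrite !Zloc_harmonic ?Zloc_harmonic2.
set A := poch _ r in C1 *; set B := poch _ r in C2 *; set D := wp_den _ _ r in C1 *.
move: EC fu C1 C2 H1 H2 H3 H4; move: (harmonic r) (harmonic (2 * r)) (harmonic2 r) (harmonic2 (2 * r)).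
move=> h h2 g g2 EC fu C1 C2 H1 H2 H3 H4.
have -> : (-1) ^+ r * (p%:R * a') * A * B / D = p%:R ^+ 1 * (a' * (-1) ^+ r * (A / D * B)) by ring.
set X := (X in Zloc_eqmod _ _ _ X).
have -> : X = p%:R ^+ 1 * (a' * (-1) ^+ r * ('C(2 * r, r)%:R *
        (1 + 2 * a' * p%:R * (h2 - h)
           + a' ^+ 2 * p%:R ^+ 2 * (2 * (h2 - h) ^+ 2 - 2 * g2 + g)))) by rewrite /X; ring.
apply: (Zeqmod_pZ 1) => //; apply: ZeqmodZ => //.
  by apply: ZlocM => //; apply: ZlocX => //; apply: ZlocN => //; exact: Zloc1.
have C12 := ZeqmodM pp _ _ C1 C2; apply: (Zeqmod_trans pp (C12 _ _)).
- by auto 10 with zloc.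
- by auto 15 with zloc.
(* The remainder is -t^2 [harmonic2 r] times the non-constant part of the other factor. *)
apply/(ZeqmodP pp); exists (- 'C(2 * r, r)%:R * p%:R ^+ 0 * a' ^+ 3 * g *
   (2 * (h2 - h) + p%:R * a' * (2 * (h2 - h) ^+ 2 - 2 * (g2 - g)))).
  by auto 20 with zloc.
by rewrite EC; field; rewrite (Zunit_neq0 fu).
Qed.

(** * Harmonic numbers and factorials around p/2 *)

Definition odd_harmonic (m : nat) : rat := \sum_(i < m) ((2 * i).+1%:R)^-1.

(** The double factorial (2m-1)!!. *)
Definition odd_fact (m : nat) : rat := \prod_(i < m) (2 * i).+1%:R.

Lemma prod_addp2 {p k : nat} {f : nat -> rat} {z : rat} : prime p -> odd p ->
  (forall j, (j < k)%N -> Zunit p (f j)) -> z \in Zloc p ->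
  Zloc_eqmod p 2 (\prod_(j < k) (f j + p%:R * z))
    ((\prod_(j < k) f j) * (1 + p%:R * (z * \sum_(j < k) (f j)^-1))).
Proof.
move=> pp po fu zp; apply: (Zeqmod_trans pp (Zeqmod_le (n := 2) 1 pp (prod_addp3 pp po fu zp))).
set S := \sum_(j < k) _; set S2 := \sum_(j < k) _.
apply/(ZeqmodP pp); exists ((\prod_(j < k) f j) * (z ^+ 2 * ((S ^+ 2 - S2) / 2))); last by ring.
have Sp : S \in Zloc p.
  by apply: (@Zloc_sum p k (fun j => (f j)^-1)) => // j jk; apply/ZunitV_int/fu.
have S2p : S2 \in Zloc p.
  apply: (@Zloc_sum p k (fun j => (f j)^-1 ^+ 2)) => // j jk.
  by apply: ZlocX => //; apply/ZunitV_int/fu.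
have Pp : \prod_(j < k) f j \in Zloc p.
  by apply: Zloc_prod => // j jk; apply/Zunit_int/fu.
have i2 := ZunitV_int (Zunit2 pp po); auto 12 with zloc.
Qed.

Lemma fact_double (m : nat) : (2 * m)`!%:R = 2 ^+ m * m`!%:R * odd_fact m.
Proof.
elim: m => [|m IH]; first by rewrite /odd_fact big_ord0 fact0 expr0 !mulr1.
rewrite mulnS !factS !natrM IH /odd_fact big_ord_recr /= exprS -/(odd_fact m).
rewrite (_ : (2 + 2 * m)%N%:R = 2 * m.+1%:R :> rat); last by rewrite -natrM mulnS.
by ring.
Qed.

Lemma harmonic_double (m : nat) : harmonic (2 * m) = harmonic m / 2 + odd_harmonic m.
Proof.
elim: m => [|m IH]; first by rewrite /odd_harmonic big_ord0 harmonic0; ring.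
rewrite mulnS !harmonicS IH /odd_harmonic big_ord_recr /= -/(odd_harmonic m).
rewrite (_ : (2 * m).+2%:R = 2 * m.+1%:R :> rat); last by rewrite -natrM mulnS.
by rewrite invfM; ring.
Qed.

Lemma harmonic_reflect {p k : nat} : prime p -> odd p -> (k < p)%N ->
  Zloc_eqmod p 1 (harmonic (p - 1 - k)) (harmonic k).
Proof.
move=> pp po kp.
have E j : (j < p)%N -> Zloc_eqmod p 1 (harmonic (p - 1 - j)) (harmonic j + harmonic (p - 1)).
  elim: j => [|j IH] jp; first by rewrite subn0 harmonic0 add0r Zeqmod_refl.
  have /(ZeqmodP pp)[w wp Ew] := IH (ltnW jp); apply/(ZeqmodP pp).
  have u1 : Zunit p (p - 1 - j)%:R by apply: Zunit_nat; lia.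
  have u2 : Zunit p j.+1%:R by apply: Zunit_nat; lia.
  (* The two removed or added reciprocals have denominators with sum p, so they combine to p over
     their product. *)
  exists (w - ((p - 1 - j)%:R)^-1 * (j.+1%:R)^-1); first by auto 10 with zloc.
  move: Ew; rewrite (_ : (p - 1 - j = (p - 1 - j.+1).+1)%N); last by lia.
  rewrite !harmonicS => /(canRL (addrK _)) ->.
  rewrite (_ : p%:R = (p - 1 - j.+1).+1%:R + j.+1%:R :> rat); last by rewrite -natrD; congr (_%:R); lia.
  have : (p - 1 - j.+1).+1%:R != 0 :> rat by rewrite pnatr_eq0.
  move: ((p - 1 - j.+1).+1%:R : rat) (j.+1%:R : rat) (Zunit_neq0 u2) => A B B0 A0.
  by field; rewrite A0 B0.
(* Taking j = p-1 in [E] gives 0 = 2 H_(p-1) modulo p, and 2 is a unit. *)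
have /(ZeqmodP pp)[w wp Ew] : Zloc_eqmod p 1 (harmonic (p - 1)) 0.
  have := E (p - 1)%N; rewrite subnn harmonic0 => /(_ _)/(ZeqmodP pp)[|w wp Ew].
    by have := prime_gt0 pp; lia.
  have u2 := Zunit2 pp po; apply/(ZeqmodP pp); exists (- w / 2); first by auto with zloc.
  by move: Ew; move: (harmonic _) => h Ew; apply: (mulIf (Zunit_neq0 u2));
    rewrite [RHS](_ : _ = - (p%:R ^+ 1 * w)); [lra | field].
have /(ZeqmodP pp)[w' wp' ->] := E k kp; apply/(ZeqmodP pp).
exists (w + w'); first by auto with zloc.
by rewrite Ew; ring.
Qed.

Lemma Zeqmod_1addp {p : nat} {x y : rat} : prime p -> Zloc_eqmod p 1 x y ->
  Zloc_eqmod p 2 (1 + p%:R * x) (1 + p%:R * y).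
Proof.
move=> pp xy; apply: ZeqmodD => //; first exact: Zeqmod_refl.
by have := Zeqmod_pZ 1 pp xy; rewrite expr1.
Qed.

Lemma Zeqmod_1addpM {p : nat} {x y : rat} : prime p -> x \in Zloc p -> y \in Zloc p ->
  Zloc_eqmod p 2 ((1 + p%:R * x) * (1 + p%:R * y)) (1 + p%:R * (x + y)).
Proof.
by move=> pp xp yp; apply/(ZeqmodP pp); exists (x * y); rewrite ?ZlocM //; ring.
Qed.

Lemma ZeqmodI {p n : nat} {c x y : rat} : prime p -> Zunit p c ->
  Zloc_eqmod p n (c * x) (c * y) -> Zloc_eqmod p n x y.
Proof.
move=> pp cu /(ZeqmodZ pp (ZunitV_int cu)).
by rewrite !mulrA mulVf ?(Zunit_neq0 cu) // !mul1r.
Qed.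

Lemma prod_mulr {F : comPzRingType} (n : nat) (c : F) (f : 'I_n -> F) :
  (\prod_(j < n) f j) * c ^+ n = \prod_(j < n) (f j * c).
Proof. by rewrite big_split /= prodr_const card_ord. Qed.

Lemma prodN {F : comPzRingType} (n : nat) (f : nat -> F) :
  \prod_(j < n) - f j = (-1) ^+ n * \prod_(j < n) f j.
Proof. by rewrite prodrN card_ord. Qed.

(** The factors of (2n)! above n are p-j with 1 <= j <= n. *)
Lemma central_fact_mod2 {p n : nat} : prime p -> p = (2 * n).+1 ->
  Zloc_eqmod p 2 (2 * n)`!%:R ((-1) ^+ n * n`!%:R ^+ 2 * (1 - p%:R * harmonic n)).
Proof.
move=> pp Ep; have po : odd p by rewrite Ep; lia.
have -> : (2 * n)`!%:R = n`!%:R * ((-1) ^+ n * \prod_(j < n) (j.+1%:R + p%:R * -1)) :> rat.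
  have := fact_shift n n; rewrite addnn -mul2n (reindex_inj rev_ord_inj) /=.
  have f0 : n`!%:R != 0 :> rat by rewrite pnatr_eq0 -lt0n fact_gt0.
  move=> /(canLR (divfK f0)) <-.
  rewrite mulrC -(prodN n (fun j => j.+1%:R + p%:R * -1)); congr (_ * _).
  apply: eq_bigr => j _.
  have jn := ltn_ord j; rewrite mulrN1 opprB -natrB; last by lia.
  by congr (_%:R); lia.
have fu : Zunit p n`!%:R by apply: Zunit_fact; lia.
have ju j : (j < n)%N -> Zunit p j.+1%:R by move=> jn; apply: Zunit_nat; lia.
have := prod_addp2 pp po ju (ZlocN pp (Zloc1 pp)).
rewrite -harmonicE -factR_prod mulN1r [p%:R * - harmonic n]mulrN => H.
rewrite (_ : _ * _ * (1 - _) = n`!%:R * ((-1) ^+ n * (n`!%:R * (1 - p%:R * harmonic n)))); last by ring.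
by do 2! (apply: ZeqmodZ => //; first by auto with zloc).
Qed.

(** The even factors give 2^n n!; the odd ones are p-2j = -2(j - p/2) with 1 <= j <= n. *)
Lemma central_fact_pow {p n : nat} : prime p -> p = (2 * n).+1 ->
  Zloc_eqmod p 2 (2 * n)`!%:R
    ((-1) ^+ n * 4 ^+ n * n`!%:R ^+ 2 * (1 - p%:R * (harmonic n / 2))).
Proof.
move=> pp Ep; have po : odd p by rewrite Ep; lia.
have u2 := Zunit2 pp po.
have -> : (2 * n)`!%:R = 4 ^+ n * ((-1) ^+ n * (n`!%:R * \prod_(j < n) (j.+1%:R + p%:R * - 2^-1))) :> rat.
  have -> : 4 ^+ n = 2 ^+ n * 2 ^+ n :> rat by rewrite -exprMn -natrM.
  have -> : (2 * n)`!%:R = 2 ^+ n * n`!%:R * (2 ^+ n * \prod_(j < n) - (j.+1%:R + p%:R * - 2^-1)) :> rat.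
    rewrite fact_double /odd_fact (reindex_inj rev_ord_inj) /=; congr (_ * _).
    rewrite mulrC prod_mulr; apply: eq_bigr => j _.
    have jn := ltn_ord j; rewrite mulrN opprB mulrBl mulfVK ?(Zunit_neq0 u2) //.
    rewrite -natrM -natrB; last by lia.
    by congr (_%:R); lia.
  by rewrite (prodN n (fun j => j.+1%:R + p%:R * - 2^-1)); ring.
have fu : Zunit p n`!%:R by apply: Zunit_fact; lia.
have ju j : (j < n)%N -> Zunit p j.+1%:R by move=> jn; apply: Zunit_nat; lia.
have := prod_addp2 pp po ju (ZlocN pp (ZunitV_int u2)).
rewrite -harmonicE -factR_prod => H.
rewrite (_ : _ * _ * (1 - _) = 4 ^+ n * ((-1) ^+ n *
  (n`!%:R * (n`!%:R * (1 + p%:R * (- 2^-1 * harmonic n)))))); last by ring.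
by do 3! (apply: ZeqmodZ => //; first by auto with zloc).
Qed.

Lemma pow4_fermat_quotient2 {p n : nat} : prime p -> p = (2 * n).+1 ->
  4 ^+ n = 1 + p%:R * fermat_quotient2 p.
Proof.
move=> pp Ep; rewrite /fermat_quotient2 mulrCA mulfV ?primeQ_neq0 // mulr1 Ep subn1 /= exprM.
by rewrite -natrX; ring.
Qed.

(* Compares the two expansions of (2n)! modulo p^2, one from the factors p - j,
   the other from the odd factors p - 2j. *)
Lemma fermat_quotient2_harmonic {p n : nat} : prime p -> p = (2 * n).+1 ->
  Zloc_eqmod p 1 (fermat_quotient2 p) (- (harmonic n / 2)).
Proof.
move=> pp Ep; have po : odd p by rewrite Ep; lia.
have u2 := Zunit2 pp po; have i2 := ZunitV_int u2.
have fu : Zunit p n`!%:R by apply: Zunit_fact; lia.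
have cu : Zunit p ((-1) ^+ n * n`!%:R ^+ 2).
  apply: ZunitM => //; apply: ZunitX => //.
  by rewrite /Zunit invrN invr1 oppr_eq0 oner_eq0 ZlocN ?Zloc1.
have := Zeqmod_trans pp (Zeqmod_sym pp (central_fact_pow pp Ep)) (central_fact_mod2 pp Ep).
rewrite (_ : _ * _ * (1 - p%:R * (_ / 2)) =
  (-1) ^+ n * n`!%:R ^+ 2 * (4 ^+ n * (1 - p%:R * (harmonic n / 2)))); last by ring.
move=> /(ZeqmodI pp cu)/(ZeqmodP pp)[w wp].
have Hp : harmonic n \in Zloc p by apply: Zloc_harmonic => //; lia.
have E4 := pow4_fermat_quotient2 pp Ep.
move: Hp E4; move: (harmonic n) (fermat_quotient2 p) => h q Hp E4 Ew.
have p0 := primeQ_neq0 pp.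
(* Substituting 4^n = 1 + pq in the leading term only and dividing by p shows that q is integral;
   then 4^n = 1 modulo p gives q = h/2 - h. *)
have Eq : q = 4 ^+ n * (h / 2) - h + p%:R * w.
  apply: (mulfI p0); move: Ew; rewrite mulrBr mulr1 {1}E4 => Ew.
  have -> : p%:R * q = 1 + p%:R * q - 4 ^+ n * (p%:R * (h / 2)) - 1 + 4 ^+ n * (p%:R * (h / 2)) by ring.
  by rewrite Ew; ring.
have qp : q \in Zloc p by rewrite Eq; auto 12 with zloc.
apply/(ZeqmodP pp); exists (q * (h / 2) + w); first by auto with zloc.
by rewrite {1}Eq E4; field.
Qed.

(** Morley's congruence modulo p^2 in factorial form: the linear term 1 - p H_n/2 is 1 + p q_p(2) =
    4^n modulo p^2, which raises 4^n to 16^n. *)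
Lemma morley_mod2 {p n : nat} : prime p -> p = (2 * n).+1 ->
  Zloc_eqmod p 2 (2 * n)`!%:R ((-1) ^+ n * 16 ^+ n * n`!%:R ^+ 2).
Proof.
move=> pp Ep; apply: (Zeqmod_trans pp (central_fact_pow pp Ep)).
have -> : (-1) ^+ n * 16 ^+ n * n`!%:R ^+ 2 =
   (-1) ^+ n * 4 ^+ n * n`!%:R ^+ 2 * (1 + p%:R * fermat_quotient2 p) :> rat.
  rewrite -(pow4_fermat_quotient2 pp Ep) (_ : 16 = 4 * 4 :> rat); last by ring.
  by rewrite exprMn; ring.
apply: ZeqmodZ => //; first by auto 10 with zloc.
rewrite -mulrN; apply: Zeqmod_1addp => //; apply: Zeqmod_sym => //.
exact: fermat_quotient2_harmonic.
Qed.

(** * The case of a residue n+m above p/2, where p = 2n+1 *)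

Lemma Zloc_odd_harmonic {p m : nat} : prime p -> (2 * m <= p)%N -> odd_harmonic m \in Zloc p.
Proof.
move=> pp mp; apply: (@Zloc_sum p m (fun i => (2 * i).+1%:R^-1)) => // i im.
by apply: Zloc_natV => //; lia.
Qed.

Lemma poch_split {F : fieldType} (x : F) (k l : nat) :
  poch x (k + l) = poch x k * poch (x + k%:R) l.
Proof.
rewrite /poch big_split_ord /=; congr (_ * _).
by apply: eq_bigr => i _; rewrite natrD addrA.
Qed.

(** H_n contributes -2 q_p(2), and the later denominators satisfy 2(n+i+1) = p + (2i+1). *)
Lemma harmonic_half_shift {p n m : nat} : prime p -> p = (2 * n).+1 -> (m <= n)%N ->
  Zloc_eqmod p 1 (harmonic (n + m)) (- 2 * fermat_quotient2 p + 2 * odd_harmonic m).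
Proof.
move=> pp Ep mn; have po : odd p by rewrite Ep; lia.
have u2 := Zunit2 pp po.
rewrite -(subrK (harmonic n) (harmonic (n + m))) addrC; apply: ZeqmodD => //.
  have := ZeqmodZ pp (ZlocN pp (Zunit_int u2)) (Zeqmod_sym pp (fermat_quotient2_harmonic pp Ep)).
  by rewrite (_ : - 2 * - (_ / 2) = harmonic n) //; field.
rewrite -harmonic_shift /odd_harmonic big_distrr /=.
apply: (@Zeqmod_sum p 1 m (fun i => (n + i).+1%:R^-1) (fun i => 2 * (2 * i).+1%:R^-1)) => // i im.
have -> : (n + i).+1%:R^-1 = 2 * ((2 * i).+1%:R + p%:R * 1)^-1 :> rat.
  rewrite mulr1 -natrD (_ : ((2 * i).+1 + p = 2 * (n + i).+1)%N); last by lia.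
  by rewrite natrM invfM mulrA mulfV ?mul1r // (Zunit_neq0 u2).
apply: ZeqmodZ; [by []|exact: Zunit_int|apply: ZeqmodV => //].
  by apply: Zunit_nat; lia.
by apply: Zeqmod_addp => //; apply: Zloc1.
Qed.

Lemma central_bin (m : nat) : 'C(2 * m, m)%:R = (2 * m)`!%:R / m`!%:R ^+ 2 :> rat.
Proof.
have m0 : m`!%:R != 0 :> rat by rewrite pnatr_eq0 -lt0n fact_gt0.
have le_m2 : (m <= 2 * m)%N by lia.
have E2 : (2 * m - m = m)%N by lia.
have := congr1 (fun k => k%:R : rat) (bin_fact le_m2); rewrite E2 !natrM => <-.
by field.
Qed.

Lemma Zunit_central_bin {p m : nat} : prime p -> (2 * m < p)%N -> Zunit p 'C(2 * m, m)%:R.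
Proof.
move=> pp mp; rewrite central_bin; apply: ZunitM => //; first exact: Zunit_fact.
by apply: ZunitV; apply: ZunitX => //; apply: Zunit_fact; lia.
Qed.

(** Doubling the factors n+j+1 of (n+m)!/n! gives p + (2j+1), hence (2m-1)!! (1 + pO) modulo p^2
    with O = [odd_harmonic m]; its inverse square produces 1 - 2pO, and Morley's congruence handles
    (2n)!. *)
Lemma fact_half_shift {p n m : nat} : prime p -> p = (2 * n).+1 -> (m < n)%N ->
  Zloc_eqmod p 2 ((2 * n)`!%:R * (2 * m)`!%:R / (n + m)`!%:R ^+ 2)
    ((-1) ^+ n * 16 ^+ (n + m) * ('C(2 * m, m)%:R)^-1 * (1 - p%:R * (2 * odd_harmonic m))).
Proof.
move=> pp Ep mn; have po : odd p by rewrite Ep; lia.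
have u2 := Zunit2 pp po.
have ou j : (j < m)%N -> Zunit p (2 * j).+1%:R by move=> jn; apply: Zunit_nat; lia.
have nu : Zunit p n`!%:R by apply: Zunit_fact; lia.
have mu : Zunit p m`!%:R by apply: Zunit_fact; lia.
have ru : Zunit p (n + m)`!%:R by apply: Zunit_fact; lia.
have Ou : Zunit p (odd_fact m) by apply: (@Zunit_prod p m (fun i => (2 * i).+1%:R)).
set O := odd_harmonic m; have Op : O \in Zloc p by apply: Zloc_odd_harmonic => //; lia.
set E' := \prod_(j < m) ((2 * j).+1%:R + p%:R * 1 : rat).
have H' : Zloc_eqmod p 2 E' (odd_fact m * (1 + p%:R * O)).
  have := prod_addp2 pp po ou (Zloc1 pp).
  by rewrite -/E' mul1r.
have Er : 2 ^+ m * (n + m)`!%:R = n`!%:R * E'.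
  have := fact_shift n m => /(canLR (divfK (Zunit_neq0 nu))) <-.
  rewrite mulrA [RHS]mulrC; congr (_ * _); rewrite mulrC prod_mulr; apply: eq_bigr => j _.
  by rewrite mulr1 -natrM -natrD; congr (_%:R); lia.
have p1u : Zunit p (1 + p%:R * O).
  by apply: Zunit_addp => //; rewrite /Zunit oner_eq0 invr1 Zloc1.
have p1V : Zloc_eqmod p 2 (1 + p%:R * O)^-1 (1 - p%:R * O).
  apply/(ZeqmodP pp); exists (O ^+ 2 * (1 + p%:R * O)^-1); first by auto with zloc.
  by field; rewrite (Zunit_neq0 p1u).
have E'u : Zunit p E'.
  exact: (Zunit_Zeqmod pp (ZunitM pp Ou p1u) (Zeqmod_le (n := 1) 1 pp H')).
have E'V : Zloc_eqmod p 2 E'^-1 ((odd_fact m)^-1 * (1 - p%:R * O)).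
  apply: (Zeqmod_trans pp (ZeqmodV pp _ _ H')) => //; first exact: ZunitM.
  by rewrite invfM; apply: ZeqmodZ => //; apply: ZunitV_int.
have E'V2 : Zloc_eqmod p 2 (E'^-1 ^+ 2) ((odd_fact m)^-1 ^+ 2 * (1 - p%:R * (2 * O))).
  apply: (Zeqmod_trans pp (ZeqmodX 2 pp _ E'V)); first by auto 10 with zloc.
  apply/(ZeqmodP pp); exists ((odd_fact m)^-1 ^+ 2 * O ^+ 2); first by auto with zloc.
  by ring.
have EC : 'C(2 * m, m)%:R = 2 ^+ m * odd_fact m / m`!%:R :> rat.
  by rewrite central_bin fact_double; field; rewrite (Zunit_neq0 mu).
have -> : (2 * n)`!%:R * (2 * m)`!%:R / (n + m)`!%:R ^+ 2 =
    (8 ^+ m * m`!%:R * odd_fact m / n`!%:R ^+ 2) * ((2 * n)`!%:R * E'^-1 ^+ 2) :> rat.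
  have -> : (n + m)`!%:R = n`!%:R * E' / 2 ^+ m.
    by rewrite -Er mulrAC mulfV ?mul1r // expf_neq0 // (Zunit_neq0 u2).
  rewrite (fact_double m) (_ : 8 = 2 * 2 * 2 :> rat); last by ring.
  rewrite !exprMn; have := expf_neq0 m (Zunit_neq0 u2); move: (2 ^+ m) => x x0.
  by field; rewrite x0 (Zunit_neq0 nu) (Zunit_neq0 E'u).
have -> : (-1) ^+ n * 16 ^+ (n + m) * ('C(2 * m, m)%:R)^-1 * (1 - p%:R * (2 * O)) =
    (8 ^+ m * m`!%:R * odd_fact m / n`!%:R ^+ 2) *
    ((-1) ^+ n * 16 ^+ n * n`!%:R ^+ 2 * ((odd_fact m)^-1 ^+ 2 * (1 - p%:R * (2 * O)))).
  rewrite EC exprD (_ : 16 ^+ m = 8 ^+ m * 2 ^+ m); last by rewrite -exprMn -natrM.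
  have := expf_neq0 m (Zunit_neq0 u2); move: (2 ^+ m) (8 ^+ m) (16 ^+ n) (_ ^+ n) => x y u s x0.
  by field; rewrite x0 (Zunit_neq0 nu) (Zunit_neq0 Ou) (Zunit_neq0 mu).
have nu2 := ZunitX 2 pp nu.
apply: ZeqmodZ => //; first by auto 10 with zloc.
apply: ZeqmodM => //; [by auto 10 with zloc | by auto 10 with zloc | exact: morley_mod2].
Qed.

Lemma Qsum_gt_half {p n m : nat} {a a' : rat} : prime p -> p = (2 * n).+1 ->
  (0 < m < n)%N -> a' \in Zloc p -> a = (n + m)%:R + p%:R * a' ->
  Zloc_eqmod p 4 (Qsum p a)
    (a' * (2 * a' + 1) / (2 * a + 1) * p%:R ^+ 2 * (-1) ^+ n * (-16) ^+ (n + m) *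
     ('C(2 * m, m)%:R)^-1 *
     (1 + p%:R * ((2 * a' + 1) / (2 * a + 1) + (2 * a' - 1) * fermat_quotient2 p
        - (2 * a' + 1) / 2 * (harmonic (n - m) - harmonic (m.-1))))).
Proof.
move=> pp Ep /andP[m0 mn]; have po : odd p by rewrite Ep; lia.
have rp : (n + m < p)%N by lia.
have n2p : (2 * n < p)%N by lia.
have m2p : (2 * m < p)%N by lia.
have m2p' : (2 * m <= p)%N by lia.
have m2p0 : (0 < 2 * m < p)%N by lia.
have rnm : (n + m + (n - m) = 2 * n)%N by lia.
have rnmp : (n + m + (n - m) < p)%N by lia.
have prn : (p - 1 - (n + m) = n - m)%N by lia.
have [l El] : exists l, (2 * m = l.+1)%N by exists (2 * m).-1; lia.
have Enm : (n + m = (n - m) + (1 + l))%N by lia.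
move=> zp Ea.
have u2 := Zunit2 pp po; have i2 := ZunitV_int u2.
rewrite {1}Ea; apply: (Zeqmod_trans pp (Qsum_eqmod_closed pp rp zp erefl)).
set t := p%:R * a'; have tp : t \in Zloc p by rewrite ZlocM ?Zloc_p.
have ru : Zunit p (n + m)`!%:R by apply: Zunit_fact.
have m2u : Zunit p (2 * m)%:R by apply: Zunit_nat.
have EpQ : p%:R = 2 * n%:R + 1 :> rat by rewrite Ep -natr1 natrM.
have Ea2 : 2 * a + 1 = (2 * m)%:R + p%:R * (2 * a' + 1).
  by rewrite Ea natrM natrD EpQ; ring.
have vp : 2 * a' + 1 \in Zloc p by auto 10 with zloc.
have au : Zunit p (2 * a + 1) by rewrite Ea2; apply: Zunit_addp.
have C1 := Zeqmod_trans pp (Zeqmod_le (n := 2) 1 pp (poch_div_den pp rp zp erefl)).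
have {}C1 : Zloc_eqmod p 2 (poch (t + 1) (n + m) / wp_den t (t ^+ 2) (n + m)) (n + m)`!%:R^-1.
  apply: C1; apply/(ZeqmodP pp); exists (- (n + m)`!%:R^-1 * a' ^+ 2 * harmonic2 (n + m)).
    by have := Zloc_harmonic2 pp rp; auto with zloc.
  by ring.
(* The n-m factors up to 2n+2t come first, then p+2t = p(2a'+1), then 2m-1 factors just above it.
   Multiplying and dividing by the next factor, 2m + p(2a'+1) = 2a+1, completes the last block to
   length 2m. *)
have Hsplit : poch (1 + (n + m)%:R + 2 * t) (n + m) =
    (p%:R * (2 * a' + 1)) * (2 * a + 1)^-1 * (poch (1 + (n + m)%:R + p%:R * (2 * a')) (n - m) *
      poch (1 + 0%:R + p%:R * (2 * a' + 1)) (2 * m)).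
  have lastE : poch (1 + 0%:R + p%:R * (2 * a' + 1)) (2 * m) =
     poch (1 + 0%:R + p%:R * (2 * a' + 1)) l * (2 * a + 1).
    by rewrite El pochS Ea2 El -(natr1 l); congr (_ * _); ring.
  rewrite lastE [X in poch _ X = _]Enm poch_split [poch _ (1 + l)]poch_split pochS poch0 mul1r addr0.
  have -> : 1 + (n + m)%:R + 2 * t = 1 + (n + m)%:R + p%:R * (2 * a') by rewrite /t; ring.
  have -> : 1 + (n + m)%:R + p%:R * (2 * a') + (n - m)%:R = p%:R * (2 * a' + 1).
    by rewrite natrB ?(ltnW mn) // natrD EpQ; ring.
  rewrite (_ : p%:R * (2 * a' + 1) + 1%:R = 1 + 0%:R + p%:R * (2 * a' + 1)); last by ring.
  move: (poch _ (n - m)) (poch _ l) => P1 P2.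
  by field; rewrite (Zunit_neq0 au).
have z2p : 2 * a' \in Zloc p by auto with zloc.
have B1 : Zloc_eqmod p 2 (poch (1 + (n + m)%:R + p%:R * (2 * a')) (n - m))
    ((2 * n)`!%:R / (n + m)`!%:R * (1 + p%:R * (2 * a' * (harmonic (2 * n) - harmonic (n + m))))).
  have := Zeqmod_le (n := 2) 1 pp (@poch_expand p (n + m) (n - m) (2 * a') pp po z2p rnmp).
  rewrite rnm => /(Zeqmod_trans pp); apply.
  have h1 : harmonic (2 * n) \in Zloc p by apply: Zloc_harmonic => //.
  have h2 : harmonic2 (2 * n) \in Zloc p by apply: Zloc_harmonic2 => //.
  have h3 := Zloc_harmonic pp rp; have h4 := Zloc_harmonic2 pp rp.
  apply/(ZeqmodP pp); exists ((2 * n)`!%:R / (n + m)`!%:R * ((2 * a') ^+ 2 *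
    (((harmonic (2 * n) - harmonic (n + m)) ^+ 2 - (harmonic2 (2 * n) - harmonic2 (n + m))) / 2))).
    by auto 20 with zloc.
  by ring.
have B2 : Zloc_eqmod p 2 (poch (1 + 0%:R + p%:R * (2 * a' + 1)) (2 * m))
    ((2 * m)`!%:R * (1 + p%:R * ((2 * a' + 1) * harmonic (2 * m)))).
  have := Zeqmod_le (n := 2) 1 pp (@poch_expand p 0 (2 * m) (2 * a' + 1) pp po vp m2p).
  rewrite add0n => /(Zeqmod_trans pp); apply.
  have h1 : harmonic (2 * m) \in Zloc p by apply: Zloc_harmonic => //.
  have h2 : harmonic2 (2 * m) \in Zloc p by apply: Zloc_harmonic2 => //.
  apply/(ZeqmodP pp); exists ((2 * m)`!%:R * ((2 * a' + 1) ^+ 2 *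
    ((harmonic (2 * m) ^+ 2 - harmonic2 (2 * m)) / 2))); first by auto 20 with zloc.
  by rewrite harmonic0 harmonic2_0 fact0 divr1; ring.
move: C1 B1 B2; rewrite Hsplit.
move: (poch (t + 1) _) (wp_den _ _ _) (poch _ (n - m)) (poch _ (2 * m)) => A D P1 P2 C1 B1 B2.
set E := (2 * a' + 1) / (2 * a + 1) + _ - _.
pose c : rat := (-1) ^+ n * 16 ^+ (n + m) * ('C(2 * m, m)%:R)^-1.
have cp : c \in Zloc p.
  have Cu : Zunit p 'C(2 * m, m)%:R by exact: Zunit_central_bin.
  by rewrite /c; auto 10 with zloc.
pose K : rat := a' * (2 * a' + 1) * (2 * a + 1)^-1 * (-1) ^+ (n + m).
have Kp : K \in Zloc p by rewrite /K; auto 12 with zloc.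
(* One p comes from t and one from p+2t, so the cofactor is needed only modulo p^2. *)
have -> : (-1) ^+ (n + m) * t * A * (p%:R * (2 * a' + 1) * (2 * a + 1)^-1 * (P1 * P2)) / D =
    p%:R ^+ 2 * (K * (A / D * (P1 * P2))).
  by rewrite /K /t; ring.
set R := (X in Zloc_eqmod _ _ _ X); have -> : R = p%:R ^+ 2 * (K * (c * (1 + p%:R * E))).
  by rewrite /R /K /c [(-16) ^+ _]exprNn; ring.
apply: (Zeqmod_pZ 2) => //; apply: ZeqmodZ => //.
have h2n : harmonic (2 * n) \in Zloc p by apply: Zloc_harmonic => //.
have hr := Zloc_harmonic pp rp.
have h2m : harmonic (2 * m) \in Zloc p by apply: Zloc_harmonic => //.
have Op : odd_harmonic m \in Zloc p by apply: Zloc_odd_harmonic => //.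
set u1 := 2 * a' * (harmonic (2 * n) - harmonic (n + m)) in B1.
set u2' := (2 * a' + 1) * harmonic (2 * m) in B2.
have u1p : u1 \in Zloc p by rewrite /u1; auto 10 with zloc.
have u2p : u2' \in Zloc p by rewrite /u2'; auto 10 with zloc.
have rV := ZunitV_int ru.
have BB := ZeqmodM pp _ _ B1 B2.
apply: (Zeqmod_trans pp (ZeqmodM pp _ _ C1 (BB _ _))); [by auto 12 with zloc..|].
have -> : (n + m)`!%:R^-1 * ((2 * n)`!%:R / (n + m)`!%:R * (1 + p%:R * u1) *
    ((2 * m)`!%:R * (1 + p%:R * u2'))) =
    (2 * n)`!%:R * (2 * m)`!%:R / (n + m)`!%:R ^+ 2 * ((1 + p%:R * u1) * (1 + p%:R * u2')).
  by field; rewrite (Zunit_neq0 ru).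
have FH := fact_half_shift pp Ep mn; rewrite -/c in FH.
apply: (Zeqmod_trans pp (ZeqmodM pp _ _ FH (Zeqmod_1addpM pp u1p u2p))); [by auto 12 with zloc..|].
rewrite -mulrA -mulrN; apply: ZeqmodZ => //.
have O2p : - (2 * odd_harmonic m) \in Zloc p by auto with zloc.
apply: (Zeqmod_trans pp (Zeqmod_1addpM pp O2p (ZlocD pp u1p u2p))).
apply: Zeqmod_1addp => //.
(* The coefficients of p are compared modulo p: all harmonic numbers are reduced to H_m,
   [odd_harmonic m] and q_p(2), and 1/(2a+1) to 1/(2m), which matches the 1/m separating H_(m-1)
   from H_m. *)
have /(ZeqmodP pp)[w1 w1p E1] := harmonic_half_shift pp Ep (ltnW mn).
have /(ZeqmodP pp)[w2 w2p E2] : Zloc_eqmod p 1 (harmonic (n - m)) (harmonic (n + m)).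
  by have := harmonic_reflect pp po rp; rewrite prn.
have /(ZeqmodP pp)[w3 w3p E3] : Zloc_eqmod p 1 (2 * a + 1)^-1 (2 * m)%:R^-1.
  by apply: ZeqmodV => //; rewrite Ea2; apply: Zeqmod_addp.
have /(ZeqmodP pp)[w4 w4p E4] : Zloc_eqmod p 1 (harmonic (2 * n)) 0.
  by have := harmonic_reflect pp po (prime_gt0 pp); rewrite harmonic0 subn0 {2}Ep subn1 /=.
have m0' : m%:R != 0 :> rat by rewrite pnatr_eq0 -lt0n.
have E5 : harmonic m.-1 = harmonic m - m%:R^-1.
  by rewrite -[in RHS](prednK m0) harmonicS; ring.
apply/(ZeqmodP pp).
exists (2 * a' * w4 + 2^-1 * w1 * (1 - 2 * a') + 2^-1 * (2 * a' + 1) * w2 - (2 * a' + 1) * w3).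
  by auto 20 with zloc.
rewrite /u1 /u2' /E E4 E2 E5 E3 harmonic_double E1 natrM.
move: (harmonic m) (odd_harmonic m) (fermat_quotient2 p) (p%:R ^+ 1) => h o q y.
by field; rewrite m0'.
Qed.

(** * Passage from a to its residue and the split at p/2 *)

Theorem theorem5p1 (p : nat) (a : rat) (p_prime : prime p) (p_odd : odd p)
    (a_int : a \in Zloc p)
    (a_neq0 : ~~ Zloc_eqmod p 1 a 0) (a_neqN1 : ~~ Zloc_eqmod p 1 a (-1)) :
  let r := Zloc_res p a in
  let a' : rat := (a - r%:R) / p%:R in
  (r%:R < p%:R / 2 :> rat ->
     Zloc_eqmod p 4 (Qsum p a)
       (a' * p%:R * (-1) ^+ r * 'C(2 * r, r)%:R *
        (1 + 2 * a' * p%:R * (harmonic (2 * r) - harmonic r)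
           + a' ^+ 2 * p%:R ^+ 2 *
             (2 * (harmonic (2 * r) - harmonic r) ^+ 2
              - 2 * harmonic2 (2 * r) + harmonic2 r))))
  /\
  (p%:R / 2 < r%:R :> rat ->
     Zloc_eqmod p 4 (Qsum p a)
       (a' * (2 * a' + 1) / (2 * a + 1) * p%:R ^+ 2
        * (-1) ^+ ((p - 1) %/ 2)%N * (-16) ^+ r
        * ('C(2 * (r - (p - 1) %/ 2), r - (p - 1) %/ 2)%:R)^-1 *
        (1 + p%:R *
             ((2 * a' + 1) / (2 * a + 1)
              + (2 * a' - 1) * fermat_quotient2 p
              - (2 * a' + 1) / 2
                * (harmonic (p - 1 - r) - harmonic (r - (p + 1) %/ 2)))))).
Proof.
have [] := Zloc_resP p_prime a_int; move: (Zloc_res p a) => r rp ar.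
cbv zeta; set a' := (a - r%:R) / p%:R; have zp : a' \in Zloc p by move: ar; rewrite /Zloc_eqmod expr1.
have Ea : a = r%:R + p%:R * a' by rewrite /a'; field; rewrite primeQ_neq0.
have p2 : 0 < 2 :> rat by [].
split=> [|lt_pr].
  rewrite ltr_pdivlMr // -natrM ltr_nat mulnC => lt_rp.
  by rewrite {1}Ea; apply: Qsum_lt_half.
have lt_p2r : (p < r * 2)%N by move: lt_pr; rewrite ltr_pdivrMr // -natrM ltr_nat.
have [n [m [Ep Er]]] : exists n m : nat, p = (2 * n).+1 /\ r = (n + m)%N.
  by exists p./2, (r - p./2)%N; split; lia.
(* Since a is not -1 modulo p, r < 2n, that is m < n; r > p/2 gives m > 0, so that r - (p+1)/2 is a
   true predecessor of m. *)
have r_neq : r != (p - 1)%N.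
  apply: contraNneq a_neqN1 => r_eq; apply: (Zeqmod_trans p_prime ar).
  rewrite r_eq natrB ?prime_gt0 //; apply/(ZeqmodP p_prime).
  by exists 1; rewrite ?Zloc1 // expr1; ring.
have m_bnd : (0 < m < n)%N by move/eqP: r_neq; lia.
have E1 : ((p - 1) %/ 2 = n)%N by lia.
have E2 : (r - n = m)%N by lia.
have E3 : (p - 1 - r = n - m)%N by lia.
have E4 : (r - (p + 1) %/ 2 = m.-1)%N by lia.
rewrite E1 E2 E3 E4 Er; apply: Qsum_gt_half => //.
by rewrite -Er.
Qed.
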